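(* Let $\pi$ be chosen uniformly at random among the derangements of $\{1,\dots,n\}$. Then the probability that the associated link $L_\pi$ is non-split tends to $1$ as $n\to\infty$.
   Context: A derangement is a permutation without fixed points. The cycle diagram $G_\pi\subset\mathbb R^2$ of a derangement $\pi\in S_n$ (with $\pi_i=\pi(i)$) is the union, over all $i$, of the vertical segment from $(i,i)$ to $(i,\pi_i)$ and the horizontal segment from $(i,\pi_i)$ to $(\pi_i,\pi_i)$. The associated link $L_\pi\subset\mathbb R^3$ is the link with planar diagram $G_\pi$, where at every crossing of a vertical segment with a horizontal segment the vertical strand passes over the horizontal strand. The components of $L_\pi$ correspond to the cycles of $\pi$. A link $L\subset\mathbb R^3$ is split if there is a surface in $\mathbb R^3$ homeomorphic to the 2-sphere that is disjoint from $L$ and has components of $L$ in both its interior and its exterior; otherwise $L$ is non-split. *)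

(* Defs.v *)
From HB Require Import structures.
From mathcomp Require Import all_boot all_order all_algebra all_fingroup.
From mathcomp Require Import all_classical all_reals all_analysis.
From mathcomp Require Import ring lra.

Set Implicit Arguments.
Unset Strict Implicit.
Unset Printing Implicit Defensive.

Import Order.TTheory GRing.Theory Num.Theory.
Import numFieldNormedType.Exports.

Local Open Scope classical_set_scope.
Local Open Scope ring_scope.

Definition derangement (n : nat) (pi : 'S_n) : bool := [forall i, pi i != i].

Section Space.
Variable R : realType.

Definition pt2 (x y : R) : 'rV[R]_2 := \row_(k < 2) [:: x; y]`_k.
Definition pt3 (x y z : R) : 'rV[R]_3 := \row_(k < 3) [:: x; y; z]`_k.

(* [ord n] is {0, ..., n-1}, whereas permutations here act on {1, ..., n}. *)
Definition coord (n : nat) (i : 'I_n) : R := i.+1%:R.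

Section CycleDiagram.
Variables (n : nat) (pi : 'S_n).

(* [line_path a b t] is (1 - t) a + t b. *)
Definition vertical_segment (i : 'I_n) : set 'rV[R]_2 :=
  [set pt2 (coord i) (line_path (coord i) (coord (pi i)) t)
    | t in `[0, 1]%classic].

Definition horizontal_segment (i : 'I_n) : set 'rV[R]_2 :=
  [set pt2 (line_path (coord i) (coord (pi i)) t) (coord (pi i))
    | t in `[0, 1]%classic].

Definition cycle_diagram : set 'rV[R]_2 :=
  \bigcup_(i in [set: 'I_n]) (vertical_segment i `|` horizontal_segment i).

(* A planar diagram determines its link up to isotopy.  We take the
   representative lying above the diagram in which horizontal strands have
   height 0 and vertical strands have height t (1 - t), t being the affine
   parameter of the segment.  Thus vertical strands are strictly above height 0
   except at their endpoints, where they are joined to horizontal strands; see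
   [proj_link] and [link_crossing] below. *)
Definition vertical_strand (i : 'I_n) : set 'rV[R]_3 :=
  [set pt3 (coord i) (line_path (coord i) (coord (pi i)) t) (t * (1 - t))
    | t in `[0, 1]%classic].

Definition horizontal_strand (i : 'I_n) : set 'rV[R]_3 :=
  [set pt3 (line_path (coord i) (coord (pi i)) t) (coord (pi i)) 0
    | t in `[0, 1]%classic].

Definition link : set 'rV[R]_3 :=
  \bigcup_(i in [set: 'I_n]) (vertical_strand i `|` horizontal_strand i).

End CycleDiagram.

Definition homeomorphic (T U : topologicalType) (A : set T) (B : set U) : Prop :=
  exists (f : T -> U) (g : U -> T),
    [/\ set_bij A B f, {in A, cancel f g},
        {within A, continuous f} & {within B, continuous g}].

Definition sphere2 : set 'rV[R]_3 :=
  [set p | \sum_(k < 3) p ord0 k ^+ 2 = 1].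

(* By the Jordan-Brouwer theorem the complement of an embedded sphere has
   exactly two connected components, a bounded and an unbounded one. *)
Definition sphere_interior (S : set 'rV[R]_3) : set 'rV[R]_3 :=
  [set p | ~ S p /\ bounded_set (connected_component (~` S) p)].

Definition sphere_exterior (S : set 'rV[R]_3) : set 'rV[R]_3 :=
  [set p | ~ S p /\ ~ bounded_set (connected_component (~` S) p)].

Definition is_link_component (L K : set 'rV[R]_3) : Prop :=
  exists2 p, L p & K = connected_component L p.

Definition split_link (L : set 'rV[R]_3) : Prop :=
  exists S : set 'rV[R]_3,
    [/\ homeomorphic sphere2 S, S `&` L = set0,
        exists2 K, is_link_component L K & K `<=` sphere_interior S &
        exists2 K, is_link_component L K & K `<=` sphere_exterior S].

(* Uniform probability on derangements, as a ratio of cardinals; the quotient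
   is 0 by convention for n = 1, where there is no derangement. *)
Definition prob_nonsplit (n : nat) : R :=
  #|[pred pi : 'S_n | derangement pi && `[< ~ split_link (link pi) >]]|%:R /
  #|[pred pi : 'S_n | derangement pi]|%:R.

Definition proj (p : 'rV[R]_3) : 'rV[R]_2 :=
  \row_(k < 2) p ord0 (widen_ord (leqnSn 2) k).

Lemma proj_pt3 x y z : proj (pt3 x y z) = pt2 x y.
Proof. by apply/rowP => k; rewrite !mxE; case: k => -[|[|]]. Qed.

Lemma proj_link n (pi : 'S_n) : proj @` link pi = cycle_diagram pi.
Proof.
apply/seteqP; split => p.
  move=> [q [i _ [] [t t01 <-]] <-]; rewrite proj_pt3; exists i => //.
    by left; exists t.
  by right; exists t.
move=> [i _ [] [t t01 <-]].
  exists (pt3 (coord i) (line_path (coord i) (coord (pi i)) t) (t * (1 - t))).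
    by exists i => //; left; exists t.
  by rewrite proj_pt3.
exists (pt3 (line_path (coord i) (coord (pi i)) t) (coord (pi i)) 0).
  by exists i => //; right; exists t.
by rewrite proj_pt3.
Qed.

Lemma coord_inj n : injective (@coord n).
Proof. by move=> i j /eqP; rewrite /coord eqr_nat => /eqP[] /val_inj. Qed.

Lemma link_crossing n (pi : 'S_n) (i j : 'I_n) p q :
  vertical_strand pi i p -> horizontal_strand pi j q -> proj p = proj q ->
  p = q \/ q ord0 ord_max < p ord0 ord_max.
Proof.
move=> [t + <-] [u + <-]; rewrite /= !in_itv /=.
move=> /andP[t0 t1] /andP[u0 u1]; rewrite !proj_pt3 => e.
have ex : coord i = line_path (coord j) (coord (pi j)) u.
  by have /rowP/(_ ord0) := e; rewrite !mxE.
have ey : line_path (coord i) (coord (pi i)) t = coord (pi j).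
  by have /rowP/(_ ord_max) := e; rewrite !mxE.
have [z|nz] := eqVneq (t * (1 - t)) 0.
  by left; rewrite z ey -ex.
right; rewrite !mxE /= lt_def nz mulr_ge0// subr_ge0//.
Qed.

End Space.

(* Main.v *)
Require Import Defs.
From mathcomp Require Import all_boot all_order all_algebra all_fingroup.
From mathcomp Require Import all_classical all_reals all_analysis.
From mathcomp Require Import ring lra zify complex.

(** Why the theorem is true.

    Write w for the permutation.  The vertical strand i passes over the
    horizontal strand j exactly when j < i < w j < w i or w i < w j < i < j
    ([passes_over]): an upward vertical strand only meets rightward horizontal
    ones, and a downward one only leftward ones.  Hence all crossings have the
    same sign, so the linking number of two sublinks is, up to sign, the number
    of times that the first passes over the second, and it is zero only if this
    never happens.  A sphere that separates two sublinks makes their linking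
    number zero.  Thus a split link yields a w-invariant set of indices, neither
    empty nor full, whose strands do not cross the other ones
    ([split_link_partition]).

    A planar argument on arcs shows that w then stabilises an interval which is
    neither empty nor full ([noncrossing_interval]).  An interval of length s is
    stabilised by s! (n - s)! permutations; for a derangement both s and n - s
    are at least 2, so that only O((n - 1)!) derangements stabilise an interval
    ([card_stable_interval]), whereas at least a third of all permutations are
    derangements ([card_derangement_ge]).

    The vanishing of the linking number is proved without homology, since the
    sphere may be wild.  Let B be the set of indices of the strands on one side
    of the sphere S and A that of the strands on the other side.  The function
    [linking_map] is continuous from space to the complex numbers and vanishes
    exactly on the strands of B.  The sphere being simply connected, the argument
    of this function has a continuous determination on S ([log_sphere]).  Extend
    that determination to space by Tietze's theorem, subtract it from the
    argument on the side of A, and replace the function by the constant 1 on the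
    side of B: the result is a continuous map from space to the circle, so it
    has a continuous determination too.  It follows that the argument of
    [linking_map] has a continuous determination along the strands of A
    ([log_separated]), so that its total variation along these closed curves is
    zero.  On the other hand this variation can be read off the formula: up to
    terms that telescope, it decreases by 2 pi each time that a strand of A
    passes over a strand of B ([increment_vertical_path] and
    [increment_horizontal_path]).  So there is no such passage
    ([separated_not_over]).

    The formula for [linking_map] comes from spin geometry.  For v in space, the
    matrix of |v| + v.sigma, sigma being the Pauli matrices, is a hermitian
    matrix of rank at most one.  For a closed polygon and a point p, the trace of
    the product of these matrices, taken at the vectors from p to the successive
    corners, has as argument half the solid angle under which p sees the polygon.
    It is zero exactly when p sees two consecutive corners in opposite
    directions or p is a corner, that is when p lies on the polygon.  The strands
    over the vertical segments are arcs of parabolas; they are dealt with by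
    letting one end of the edge depend on p, see [lift_height]. *)

Set Implicit Arguments.
Unset Strict Implicit.
Unset Printing Implicit Defensive.

(** * Non-crossing invariant sets and stabilised intervals *)

Definition passes_over n (pi : 'S_n) (i j : 'I_n) : bool :=
  ((j < i < pi j) && (pi j < pi i))%N || ((pi i < pi j) && (pi j < i < j))%N.

Section NonCrossing.
Import mathcomp.boot.fintype mathcomp.boot.finset.
Variables (n : nat) (w : 'S_n).
Implicit Types (i j k x y : 'I_n) (T Y A : {set 'I_n}).

(** Finiteness: a set and its preimage under a permutation have the same size. *)
Lemma forward_closed T : (forall i, i \in T -> w i \in T) ->
  forall i, (w i \in T) = (i \in T).
Proof.
move=> wT i; apply/idP/idP => [wi|]; last exact: wT.
have sub : T \subset w @^-1: T by apply/subsetP => x xT; rewrite inE wT.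
have := subset_cardP (esym (card_preimset T (@perm_inj _ w))) sub i.
by rewrite inE wi.
Qed.

Lemma backward_closed T : (forall i, w i \in T -> i \in T) ->
  forall i, (w i \in T) = (i \in T).
Proof.
move=> wT i; apply/idP/idP => [|iT]; first exact: wT.
have sub : w @^-1: T \subset T by apply/subsetP => x; rewrite inE; exact: wT.
have := subset_cardP (card_preimset T (@perm_inj _ w)) sub i.
by rewrite inE iT.
Qed.

Definition stabilises (a b : nat) : bool :=
  [forall i, (a <= w i <= b)%N == (a <= i <= b)%N].

(** Let k be the least element of Y and m the least bound such that no arc of Y
    goes from [0, m] to its complement; then [k, m] is the interval sought.  By
    minimality of m, each point x of it outside Y lies under an increasing arc
    of Y contained in [k, m], and since w permutes the points of Y up to m, also
    over a decreasing one.  An arc that leads from x out of the interval would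
    cross the first of these if it goes to the right, the second if it goes to
    the left. *)
Lemma noncrossing_class_interval Y : Y != set0 ->
  (forall y, y \in Y -> (0 < y)%N) -> (forall i, (w i \in Y) = (i \in Y)) ->
  (forall x y, x \notin Y -> y \in Y -> ~~ passes_over w x y) ->
  exists a b, [/\ 0 < a, a <= b, b < n & stabilises a b]%N.
Proof.
move=> /set0Pn[y0 y0Y] Ypos wY nover.
pose k := [arg min_(i < y0 in Y) (i : nat)].
have [kY kmin] : k \in Y /\ forall y, y \in Y -> (k <= y)%N.
  by rewrite /k; case: arg_minnP.
have nX x y : x \notin Y -> y \in Y -> (x : nat) <> y.
  by move=> xY yY /val_inj e; move: xY; rewrite e yY.
pose P m := (k <= m)%N && [forall y in Y, (y <= m)%N ==> (w y <= m)%N].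
have Pn : P n.-1.
  apply/andP; split; first by have := ltn_ord k; lia.
  by apply/forall_inP => y _; apply/implyP => _; have := ltn_ord (w y); lia.
have [m /andP[km /forall_inP Pm] minm] := ex_minnP (ex_intro P _ Pn).
have {}Pm y : y \in Y -> (y <= m)%N -> (w y <= m)%N by move=> /Pm/implyP.
have mn : (m < n)%N by have := minm _ Pn; have := ltn_ord k; lia.
have Tm y : y \in Y -> (w y <= m)%N -> (y <= m)%N.
  move=> yY wym; pose T := [set y in Y | (y <= m)%N].
  have Tw i : i \in T -> w i \in T by rewrite !inE wY => /andP[iY /Pm ->]//; rewrite iY.
  by have := forward_closed Tw y; rewrite !inE wY yY wym.
(* a foreign point of the interval is below an increasing arc of Y and above a
   decreasing one *)
have upY x : x \notin Y -> (k < x <= m)%N -> exists2 j,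
  j \in Y & (j < x < w j)%N && (w j <= m)%N.
  move=> xY /andP[kx xm]; have : ~~ P x.-1 by apply/negP => /minm; lia.
  rewrite /P negb_and => /orP[|]; first by lia.
  move=> /forall_inPn[j jY]; rewrite negb_imply => /andP[jx wjx].
  exists j => //; have := nX x (w j) xY; rewrite wY => /(_ jY) ne.
  have := Pm j jY; lia.
have downY x : x \notin Y -> (k < x <= m)%N ->
  exists2 j, j \in Y & (w j < x < j)%N && (j <= m)%N.
  move=> xY kxm; have [j jY /andP[jx jm]] := upY x xY kxm.
  pose T := [set y in Y | (y < x)%N].
  have [/existsP[y /andP[yY /andP[wy yx]]]|/existsPn none] :=
    boolP [exists y, (y \in Y) && ((w y < x)%N && (x <= y)%N)].
    exists y => //; have := nX x y xY yY; have := Tm y yY; lia.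
  have Tw i : w i \in T -> i \in T.
    rewrite !inE wY => /andP[iY wi]; rewrite iY /=.
    by have := none i; rewrite iY wi /= -ltnNge.
  have := backward_closed Tw j; rewrite !inE wY jY /=; lia.
(* by finiteness it is enough that w maps the interval to itself *)
exists k, m; split => //; first exact: Ypos.
pose T := [set i : 'I_n | (k <= i <= m)%N].
have Tw i : i \in T -> w i \in T.
  rewrite !inE => /andP[ki im]; have [iY|iY] := boolP (i \in Y).
    by rewrite (Pm i iY im) kmin ?wY.
  have kx : (k < i <= m)%N by have := nX i k iY kY; lia.
  apply/andP; split; rewrite leqNgt; apply/negP => h.
    have [j jY /andP[jx jm]] := downY i iY kx.
    have := nover i j iY jY; have := kmin (w j); rewrite wY /passes_over => /(_ jY); lia.
  have [j jY /andP[jx jm]] := upY i iY kx.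
  have := nover i j iY jY; rewrite /passes_over; lia.
apply/forallP => i; apply/eqP; have := forward_closed Tw i.
by rewrite !inE.
Qed.

(** The set or its complement avoids the index 0, which makes the interval proper. *)
Lemma noncrossing_interval A : A != set0 -> A != setT ->
  (forall i, (w i \in A) = (i \in A)) ->
  (forall i j, (i \in A) != (j \in A) -> ~~ passes_over w i j) ->
  exists a b, [/\ 0 < a, a <= b, b < n & stabilises a b]%N.
Proof.
move=> A0 AT wA nover.
have [Y Yd Ypos] : exists2 Y, Y = A \/ Y = ~: A & forall y, y \in Y -> (0 < y)%N.
  have [/existsP[i /andP[iA /eqP i0]]|/existsPn noz] :=
    boolP [exists i, (i \in A) && ((i : nat) == 0)].
    exists (~: A) => [|y]; first by right.
    rewrite inE lt0n; apply: contra => /eqP y0.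
    by have -> : y = i by apply/val_inj; rewrite /= y0 i0.
  exists A => [|y yA]; first by left.
  by have := noz y; rewrite yA lt0n.
have YA i j : ((i \in Y) != (j \in Y)) = ((i \in A) != (j \in A)).
  by case: Yd => ->; rewrite ?inE //; case: (i \in A); case: (j \in A).
apply: (@noncrossing_class_interval Y) => //.
- case: Yd => -> //; apply: contra AT => /eqP e; apply/eqP.
  by rewrite -[A]setCK e setC0.
- by move=> i; case: Yd => ->; rewrite ?inE wA.
- by move=> x y xY yY; apply: nover; rewrite -YA yY; case: (x \in Y) xY.
Qed.

End NonCrossing.

(** * Counting derangements and stabilisers of intervals *)

Section Counting.
Import mathcomp.boot.fintype mathcomp.boot.finset.
Variable n : nat.
Implicit Types (w : 'S_n) (S : {set 'I_n}).

Definition fixed_points w := [set i | w i == i].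

(** Double counting of the pairs of a permutation and a set of r of its fixed
    points: the factorial moments of the number of fixed points are those of a
    Poisson variable of mean 1. *)
Lemma sum_binomial_fixed_points r : (r <= n)%N ->
  (r`! * \sum_(w : 'S_n) 'C(#|fixed_points w|, r) = n`!)%N.
Proof.
move=> rn.
have -> : (\sum_(w : 'S_n) 'C(#|fixed_points w|, r) =
  \sum_(S : {set 'I_n} | #|S| == r) #|[set w : 'S_n | perm_on (~: S) w]|)%N.
  transitivity (\sum_(w : 'S_n) \sum_(S : {set 'I_n} | #|S| == r) (perm_on (~: S) w :
    nat))%N.
    apply: eq_bigr => w _; rewrite -cards_draws -sum1_card big_mkcond [RHS]big_mkcond /=.
    apply: eq_bigr => S _; rewrite inE andbC; case: (#|S| == r) => //=.
    have -> : (S \subset fixed_points w) = perm_on (~: S) w.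
      apply/subsetP/subsetP => h x.
        by rewrite !inE; apply: contra => /h; rewrite inE.
      by move=> xS; rewrite inE; apply: contraTT xS => xw; have := h x; rewrite !inE;
        apply.
    by case: perm_on.
  rewrite exchange_big /=; apply: eq_bigr => S _.
  rewrite -sum1_card big_mkcond [RHS]big_mkcond /=; apply: eq_bigr => w _.
  by rewrite inE; case: perm_on.
rewrite (eq_bigr (fun=> (n - r)`!)) => [|S /eqP Sr]; last first.
  by rewrite cardsE card_perm cardsCs setCK card_ord Sr.
rewrite sum_nat_const.
have -> : #|[pred S : {set 'I_n} | #|S| == r]| = 'C(n, r).
  rewrite -[in RHS](card_ord n) -card_draws; apply: eq_card => S; rewrite !inE.
  by [].
by rewrite mulnA [(r`! * _)%N]mulnC -mulnA bin_fact.
Qed.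

(** Pointwise form of the Bonferroni inequality of order 3. *)
Lemma bonferroni3 m : (1 + 'C(m, 2) <= (m == 0) + m + 'C(m, 3))%N.
Proof.
case: m => [|m] //; rewrite !binS bin1; lia.
Qed.

Lemma derangement_fixed w : derangement w = (#|fixed_points w| == 0).
Proof.
rewrite cards_eq0; apply/forallP/eqP => [h|h i].
  by apply/setP => i; rewrite !inE (negbTE (h i)).
by have := in_set0 i; rewrite -h inE => ->.
Qed.

Lemma card_derangement_ge : (2 < n)%N -> (n`! <= 3 * #|[pred w : 'S_n | derangement
  w]|)%N.
Proof.
move=> n2.
have s1 := @sum_binomial_fixed_points 1 (ltnW (ltnW n2)).
have s2 := @sum_binomial_fixed_points 2 (ltnW n2).
have s3 := @sum_binomial_fixed_points 3 n2.
have : (\sum_(w : 'S_n) (1 + 'C(#|fixed_points w|, 2)) <=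
  \sum_(w : 'S_n) ((#|fixed_points w| == 0) + #|fixed_points w| + 'C(#|fixed_points w|,
    3)))%N.
  by apply: leq_sum => w _; exact: bonferroni3.
rewrite !big_split /= sum1_card card_Sn.
have -> : (\sum_(w : 'S_n) (#|fixed_points w| == 0) = #|[pred w : 'S_n | derangement
  w]|)%N.
  rewrite -sum1_card [RHS]big_mkcond /=; apply: eq_bigr => w _.
  by rewrite inE derangement_fixed; case: (_ == _).
have -> : (\sum_(w : 'S_n) #|fixed_points w| = \sum_(w : 'S_n) 'C(#|fixed_points w|,
  1))%N.
  by apply: eq_bigr => w _; rewrite bin1.
have key (a b c d e : nat) : (1`! * a = e -> 2`! * b = e -> 3`! * c = e ->
  e + b <= d + a + c -> e <= 3 * d)%N by rewrite !factS fact0; lia.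
exact: key s1 s2 s3.
Qed.

(** Such a permutation is determined by its restrictions to S and to its complement. *)
Lemma card_stabiliser_le S :
  (#|[set w : 'S_n | [forall i, (w i \in S) == (i \in S)]]| <= (#|S|)`! * (n - #|S|)`!)%N.
Proof.
pose f (w : 'S_n) := (restr_perm S w, restr_perm (~: S) w).
pose St := [set w : 'S_n | [forall i, (w i \in S) == (i \in S)]].
have StN w : w \in St -> w \in 'N(S | 'P)%g /\ w \in 'N(~: S | 'P)%g.
  rewrite inE => /forallP h; split; apply/astabsP => x; rewrite /aperm /= ?inE.
    exact/eqP/h.
  by rewrite (eqP (h x)).
have inj : {in St &, injective f}.
  move=> u v /StN[u1 u2] /StN[v1 v2] [e1 e2]; apply/permP => x.
  have [xS|xS] := boolP (x \in S).
    by rewrite -(restr_permE u1 xS) -(restr_permE v1 xS) e1.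
  have {}xS : x \in ~: S by rewrite inE.
  by rewrite -(restr_permE u2 xS) -(restr_permE v2 xS) e2.
rewrite -(card_in_imset inj); apply: (@leq_trans #|finset.setX (Sym S) (Sym (~: S))|).
  apply/subset_leq_card/subsetP => _ /imsetP[w _ ->].
  by rewrite !inE /= !restr_perm_on.
by rewrite cardsX !card_Sym [#|~: S|]cardsCs setCK card_ord.
Qed.

(** Products of factorials with a given sum decrease towards the middle. *)
Lemma fact_mul_le r a b : (r <= a -> r <= b -> a`! * b`! <= r`! * (a + b - r)`!)%N.
Proof.
move=> ra rb; rewrite -(subnKC ra); move: (a - r)%N => x {a ra}.
elim: x => [|x IH]; first by rewrite addn0 addKn.
have -> : (r + x.+1 + b - r = (b + x).+1)%N by lia.
have e : (r + x + b - r = b + x)%N by lia.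
rewrite e in IH; rewrite addnS !factS -mulnA [leqRHS]mulnCA.
by apply: leq_mul => //; lia.
Qed.

End Counting.

Section StableIntervals.
Import mathcomp.boot.fintype mathcomp.boot.finset.
Variable n : nat.
Implicit Types (w : 'S_n) (S : {set 'I_n}).

Definition interval (a s : nat) : {set 'I_n} := [set i : 'I_n | a <= i < a + s].

Lemma card_interval a s : (a + s <= n)%N -> #|interval a s| = s.
Proof.
elim: s => [|s IH] asn.
  by apply/eqP; rewrite cards_eq0; apply/eqP/setP => i; rewrite !inE; lia.
have lt : (a + s < n)%N by lia.
have -> : interval a s.+1 = Ordinal lt |: interval a s.
  by apply/setP => i; rewrite !inE -val_eqE /=; lia.
by rewrite cardsU1 IH ?inE /=; lia.
Qed.

Definition stable_interval w :=
  [exists a : 'I_n, exists b : 'I_n, (0 < a <= b) && stabilises w a b].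

(** An interval of length 1 would consist of a fixed point.  One of length n - 1
    that avoids 0 would leave 0 fixed. *)
Lemma derangement_stable_interval w : derangement w -> stable_interval w ->
  exists a s : 'I_n, [&& 2 <= s, s <= n - 2, a + s <= n &
    [forall i, (w i \in interval a s) == (i \in interval a s)]].
Proof.
move=> der /existsP[a /existsP[b /andP[ab /forallP st]]].
have {}st i : (a <= w i <= b) = (a <= i <= b) by exact/eqP/st.
have bn := ltn_ord b.
have sn : (b - a + 1 < n)%N by lia.
have fixn i : (w i : nat) <> i.
  by move=> /val_inj wi; move/forallP: der => /(_ i); rewrite wi eqxx.
exists a, (Ordinal sn); apply/and4P; split => /=.
- rewrite leqNgt; apply/negP => ba; have := st a; have := fixn a; lia.
- rewrite leqNgt; apply/negP => ba; have n0 : (0 < n)%N by lia.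
  have := st (Ordinal n0); have := fixn (Ordinal n0); have := ltn_ord (w (Ordinal n0));
    rewrite /=; lia.
- lia.
- apply/forallP => i; have := st i; rewrite !inE; lia.
Qed.

(** The lengths 2 and n - 2 are counted apart because each of the about n^2
    intervals may only cost O((n - 3)!), while there are only O(n) intervals of
    these two lengths. *)
Lemma interval_cost s : (5 < n -> 2 <= s <= n - 2 ->
  s`! * (n - s)`! <= 6 * (n - 3)`! + ((s == 2) + (s == n - 2)) * (2 * (n - 2)`!))%N.
Proof.
move=> n5 sb; have sn : (s + (n - s) = n)%N by lia.
have [s2|ns2] := boolP ((s == 2) || (s == n - 2)).
  have := @fact_mul_le 2 s (n - s); rewrite sn !factS fact0 !muln1 => h.
  apply: leq_trans (h _ _) _; [lia|lia|].
  by apply: leq_trans (leq_addl _ _); rewrite leq_pmull//; lia.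
have := @fact_mul_le 3 s (n - s); rewrite sn !factS fact0 => h.
by apply: leq_trans (h _ _) _; [lia|lia|lia].
Qed.

Lemma sum_indicator (o : nat) (d : nat) : (\sum_(s < n) (s == o :> nat) * d <= d)%N.
Proof.
rewrite -big_distrl /= -[leqRHS]mul1n leq_mul2r; apply/orP; right.
have [on|no] := ltnP o n.
  rewrite (bigD1 (Ordinal on)) //= eqxx big1 // => i.
  by rewrite -val_eqE /= => /negbTE ->.
by rewrite big1 // => i _; have := ltn_ord i; case: eqP => //; lia.
Qed.

Lemma card_stable_interval : (5 < n)%N ->
  (n.-1 * #|[pred w : 'S_n | derangement w && stable_interval w]| <= 13 * n`!)%N.
Proof.
move=> n5.
have : (#|[pred w : 'S_n | derangement w && stable_interval w]| <=
  \sum_(a < n) \sum_(s < n) (6 * (n - 3)`! +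
    ((s == 2 :> nat) + (s == n - 2 :> nat)) * (2 * (n - 2)`!)))%N.
  pose ok (a s : 'I_n) := [&& 2 <= s, s <= n - 2 & a + s <= n].
  pose st (a s : 'I_n) (w : 'S_n) := [forall i,
    (w i \in interval a s) == (i \in interval a s)].
  apply: (@leq_trans (\sum_(w : 'S_n) \sum_(a < n) \sum_(s < n) (ok a s && st a s w))).
    rewrite -sum1_card big_mkcond; apply: leq_sum => w _; rewrite inE.
    case: ifP => // /andP[der /(derangement_stable_interval der)[a [s h]]].
    rewrite (bigD1 a) //= (bigD1 s) //=.
    have -> : ok a s && st a s w by rewrite /ok /st -!andbA.
    by rewrite -!addnA leq_addr.
  rewrite exchange_big /=; apply: leq_sum => a _; rewrite exchange_big /=;
    apply: leq_sum => s _.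
  have [oks|nok] := boolP (ok a s); last by rewrite big1.
  move/and3P: oks => [s2 sn asn].
  apply: leq_trans (interval_cost n5 _); last by rewrite s2.
  rewrite -[s in s`!](card_interval asn) -[s in (n - s)`!](card_interval asn).
  apply: leq_trans (card_stabiliser_le _).
  rewrite -sum1_card [leqRHS]big_mkcond /=; apply: leq_sum => w _.
  by rewrite inE /st; case: ifP.
set bad := #|_| => h.
have {}h : (bad <= n * (n * (6 * (n - 3)`!) + 2 * (2 * (n - 2)`!)))%N.
  apply: leq_trans h _; rewrite sum_nat_const card_ord leq_mul2l; apply/orP; right.
  rewrite big_split /= sum_nat_const card_ord leq_add2l.
  rewrite (eq_bigr (fun s : 'I_n => (s == 2 :> nat) * (2 * (n - 2)`!) +
    (s == n - 2 :> nat) * (2 * (n - 2)`!))%N); last first.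
    by move=> s _; rewrite mulnDl.
  by rewrite big_split /= [leqRHS]mul2n -addnn; apply: leq_add; exact: sum_indicator.
have [m nm] : exists m, n = m.+3 by exists (n - 3)%N; lia.
move: h; move: bad => bad; rewrite nm /=.
have -> : (m.+3 - 3 = m)%N by lia.
have -> : (m.+3 - 2 = m.+1)%N by lia.
rewrite !factS; move: (m`!) (fact_gt0 m) => F F0 h.
(* for n = m + 3 the bound becomes 6 (m + 3) + 4 (m + 1) <= 13 (m + 1) *)
have m3 : (3 <= m)%N by lia.
apply: (@leq_trans (m.+2 * (m.+3 * (m.+3 * (6 * F) + 2 * (2 * (m.+1 * F)))))).
  by rewrite leq_mul2l h orbT.
rewrite (_ : m.+2 * _ = (m.+2 * m.+3 * F) * (6 * m.+3 + 4 * m.+1))%N; last by lia.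
rewrite (_ : 13 * _ = (m.+2 * m.+3 * F) * (13 * m.+1))%N; last by lia.
by rewrite leq_mul2l; apply/orP; right; lia.
Qed.

End StableIntervals.

Import Order.TTheory GRing.Theory Num.Theory.
Import numFieldNormedType.Exports.
Local Open Scope classical_set_scope.
Local Open Scope ring_scope.
Local Open Scope complex_scope.

(** * Arguments of complex numbers and their variation along paths *)

Section ComplexContinuity.
Variables (R : realType) (T : topologicalType).
Implicit Types (f g : T -> R[i]) (x : T).

Lemma continuous_add (u v : T -> R) x : {for x, continuous u} ->
  {for x, continuous v} -> continuous_at x (fun y => u y + v y).
Proof. exact: (@continuousD _ R^o). Qed.

Lemma continuous_sub (u v : T -> R) x : {for x, continuous u} ->
  {for x, continuous v} -> continuous_at x (fun y => u y - v y).
Proof. exact: (@continuousB _ R^o). Qed.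

Definition ccontinuous_at f x :=
  {for x, continuous (fun y => complex.Re (f y))} /\
  {for x, continuous (fun y => complex.Im (f y))}.

Lemma ccontinuous_cst (c : R[i]) x : ccontinuous_at (fun=> c) x.
Proof. by split; exact: cst_continuous. Qed.

Lemma ccontinuousD f g x : ccontinuous_at f x -> ccontinuous_at g x ->
  ccontinuous_at (fun y => f y + g y) x.
Proof.
move=> [f1 f2] [g1 g2]; split.
  rewrite (_ : (fun y => _) = (fun y => complex.Re (f y)) \+ (fun y => complex.Re (g y))).
    exact: (@continuousD _ R^o).
  by apply/funext => y /=; case: (f y) (g y) => ? ? [].
rewrite (_ : (fun y => _) = (fun y => complex.Im (f y)) \+ (fun y => complex.Im (g y))).
  exact: (@continuousD _ R^o).
by apply/funext => y /=; case: (f y) (g y) => ? ? [].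
Qed.

Lemma ccontinuousM f g x : ccontinuous_at f x -> ccontinuous_at g x ->
  ccontinuous_at (fun y => f y * g y) x.
Proof.
move=> [f1 f2] [g1 g2]; split.
  rewrite (_ : (fun y => _) =
    ((fun y => complex.Re (f y)) \* (fun y => complex.Re (g y)))
    \- ((fun y => complex.Im (f y)) \* (fun y => complex.Im (g y)))).
    by apply: (@continuousB _ R^o); exact: continuousM.
  by apply/funext => y /=; case: (f y) (g y) => ? ? [].
rewrite (_ : (fun y => _) =
  ((fun y => complex.Re (f y)) \* (fun y => complex.Im (g y)))
    \+ ((fun y => complex.Im (f y)) \* (fun y => complex.Re (g y)))).
  by apply: (@continuousD _ R^o); exact: continuousM.
by apply/funext => y /=; case: (f y) (g y) => ? ? [].
Qed.

Lemma ccontinuous_conj f x : ccontinuous_at f x -> ccontinuous_at (fun y => (f y)^*) x.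
Proof.
move=> [c1 c2]; split.
  rewrite (_ : (fun y => _) = (fun y => complex.Re (f y))) //.
  by apply/funext => y; case: (f y).
rewrite (_ : (fun y => _) = (fun y => - complex.Im (f y))).
  exact: (@continuousN _ R^o).
by apply/funext => y; case: (f y).
Qed.

Lemma ccontinuous_sum (I : Type) (r : seq I) (P : pred I) (F : I -> T -> R[i]) x :
  (forall i, P i -> ccontinuous_at (F i) x) ->
  ccontinuous_at (fun y => \sum_(i <- r | P i) F i y) x.
Proof.
move=> cF; elim: r => [|i r IH].
  by under [X in ccontinuous_at X]funext do rewrite big_nil; exact: ccontinuous_cst.
under [X in ccontinuous_at X]funext do rewrite big_cons.
by case: (P i) (cF i) => // cFi; apply: ccontinuousD => //; exact: cFi.
Qed.

Lemma ccontinuous_prod (I : Type) (r : seq I) (P : pred I) (F : I -> T -> R[i]) x :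
  (forall i, P i -> ccontinuous_at (F i) x) ->
  ccontinuous_at (fun y => \prod_(i <- r | P i) F i y) x.
Proof.
move=> cF; elim: r => [|i r IH].
  by under [X in ccontinuous_at X]funext do rewrite big_nil; exact: ccontinuous_cst.
under [X in ccontinuous_at X]funext do rewrite big_cons.
by case: (P i) (cF i) => // cFi; apply: ccontinuousM => //; exact: cFi.
Qed.

End ComplexContinuity.

Lemma ccontinuous_comp (R : realType) (T U : topologicalType)
    (m : T -> U) (u : U -> R[i]) x :
  {for x, continuous m} -> ccontinuous_at u (m x) -> ccontinuous_at (u \o m) x.
Proof.
move=> cm [c1 c2]; split.
  exact: (@continuous_comp _ _ _ m (fun q => complex.Re (u q))).
exact: (@continuous_comp _ _ _ m (fun q => complex.Im (u q))).
Qed.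

Section Arg.
Variable R : realType.
Implicit Types (z w : R[i]) (x y t : R).

Definition cis t : R[i] := cos t +i* sin t.

Lemma cisD x y : cis (x + y) = cis x * cis y.
Proof. by rewrite /cis cosD sinD; congr (_ +i* _); ring. Qed.

Lemma cis0 : cis 0 = 1.
Proof. by rewrite /cis cos0 sin0. Qed.

Lemma cisNK x : cis (- x) * cis x = 1.
Proof. by rewrite -cisD addNr cis0. Qed.

Lemma cis_pi : cis pi = - 1.
Proof. by rewrite /cis cospi sinpi; congr (_ +i* _); rewrite oppr0. Qed.

Lemma cis_eq1 x : cis x = 1 -> `|x| < pi *+ 2 -> x = 0.
Proof.
move=> /(congr1 (@complex.Re R))/= c1; rewrite ltr_norml => /andP[xl xr].
have s0 : sin (x / 2) = 0.
  have := cos_mulr2n (x / 2).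
  have -> : (x / 2) *+ 2 = x by rewrite -mulr_natr; field.
  rewrite c1 cos2sin2 => h; apply/eqP; rewrite -sqrf_eq0; apply/eqP.
  move: h; rewrite -mulr_natr; lra.
have [x0|x0|//] := ltgtP x 0.
  have : 0 < sin (- (x / 2)) by apply: sin_gt0_pi; rewrite -mulr_natr in xl; lra.
  by rewrite sinN s0 oppr0 ltxx.
have : 0 < sin (x / 2) by apply: sin_gt0_pi; rewrite -mulr_natr in xr; lra.
by rewrite s0 ltxx.
Qed.

Definition is_arg z t := exists2 r, 0 < r & z = r%:C * cis t.

Lemma is_argM z w x y : is_arg z x -> is_arg w y -> is_arg (z * w) (x + y).
Proof.
move=> [r r0 ->] [s s0 ->]; exists (r * s); first exact: mulr_gt0.
by rewrite cisD rmorphM/=; ring.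
Qed.

Lemma is_arg_cis x : is_arg (cis x) x.
Proof. by exists 1 => //; rewrite mul1r. Qed.

Lemma is_arg_pos r : 0 < r -> is_arg r%:C 0.
Proof. by move=> r0; exists r => //; rewrite cis0 mulr1. Qed.

Lemma is_argN z t : is_arg (- z) t -> is_arg z (t + pi).
Proof.
move=> zt; rewrite -[z]opprK -mulrN1; apply: is_argM => //.
by rewrite -cis_pi; exact: is_arg_cis.
Qed.

Lemma is_arg_uniq z x y : is_arg z x -> is_arg z y -> cis (x - y) = 1.
Proof.
move=> [r r0 ->] [s s0] rs.
suff e : cis x = cis y by rewrite cisD e -cisD subrr cis0.
case: rs => e1 e2.
have rc : r * cos x = s * cos y by move: e1; lra.
have rsi : r * sin x = s * sin y by move: e2; lra.
have : r ^+ 2 = s ^+ 2.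
  rewrite -[LHS]mulr1 -[RHS]mulr1 -{1}(cos2Dsin2 x) -(cos2Dsin2 y).
  by rewrite !mulrDr -!exprMn rc rsi.
move=> /eqP; rewrite eqrXn2 ?ltW// => /eqP e.
move: rc rsi; rewrite e => /(mulfI (lt0r_neq0 s0)) ec /(mulfI (lt0r_neq0 s0)) es.
by rewrite /cis ec es.
Qed.

Definition modulus z := Num.sqrt (complex.Re z ^+ 2 + complex.Im z ^+ 2).

Definition slit_plane z := (complex.Im z != 0) || (0 < complex.Re z).

(** The half-angle formula for the principal argument, chosen because it is
    continuous on the whole slit plane at once; it is meaningless outside. *)
Definition arg z := 2 * atan (complex.Im z / (modulus z + complex.Re z)).

Lemma modulus_sqr z : modulus z ^+ 2 = complex.Re z ^+ 2 + complex.Im z ^+ 2.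
Proof. by rewrite sqr_sqrtr// addr_ge0// sqr_ge0. Qed.

Lemma modulus_ge0 z : 0 <= modulus z. Proof. exact: sqrtr_ge0. Qed.

Lemma slit_plane_gt0 z : slit_plane z -> 0 < modulus z + complex.Re z.
Proof.
have n2 := modulus_sqr z; have n0 := modulus_ge0 z.
move=> /orP[i0|r0]; last by rewrite ltr_wpDl.
have : 0 < complex.Im z ^+ 2 by rewrite lt_def sqr_ge0 sqrf_eq0 i0.
move: n2 n0; set a := complex.Re z; set b := complex.Im z ^+ 2; set n := modulus z.
move=> n2 n0 b0; rewrite ltNge; apply/negP => h; nra.
Qed.

Lemma is_arg_arg z : slit_plane z -> is_arg z (arg z).
Proof.
move=> /slit_plane_gt0; have := modulus_sqr z; have := modulus_ge0 z.
rewrite /arg /is_arg; set n := modulus z; case: z @n => a b /=.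
set n := modulus _ => n0 n2 p0.
have b2 : b ^+ 2 = n ^+ 2 - a ^+ 2 by rewrite n2 addrC addKr.
have p1 : n + a != 0 by exact: lt0r_neq0.
have nn : 0 < n.
  rewrite lt_def n0 andbT; apply/eqP => n00; move: n2 p0; rewrite n00; nra.
have nn1 : n != 0 by exact: lt0r_neq0.
exists n => //; rewrite /cis.
set u := b / _; set q := Num.sqrt (1 + u ^+ 2).
have q2 : q ^+ 2 = 1 + u ^+ 2 by rewrite sqr_sqrtr// addr_ge0// sqr_ge0.
have q0 : q != 0 by apply/eqP => q0; move: q2; rewrite q0; nra.
have qc : cos (atan u) = q^-1 by exact: cos_atan.
have qs : sin (atan u) = u / q.
  have := atanK u; rewrite /tan qc invrK => {2}<-.
  by rewrite -mulrA divff ?mulr1.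
have u2 : 1 + u ^+ 2 = 2 * n / (n + a).
  by rewrite /u expr_div_n b2; field.
have qq : q^-1 ^+ 2 = (n + a) / (2 * n).
  by rewrite exprVn q2 u2; field; rewrite p1 nn1.
rewrite mulr_natl cos_mulr2n sin_mulr2n qc qs.
rewrite qq (_ : q^-1 * (u / q) = u * q^-1 ^+ 2); last first.
  by rewrite expr2 mulrCA.
rewrite qq /u /real_complex_def; clearbody n; clear - p1 nn1.
apply/eqP; rewrite eq_complex /= mul0r mul0r subr0 addr0; apply/andP; split.
  by apply/eqP; field.
by apply/eqP; field; rewrite p1 nn1.
Qed.

End Arg.

Section ArgIncrement.
Variable R : realType.
Implicit Types (z w : R[i]).

Lemma arg_continuous (T : topologicalType) (f : T -> R[i]) p :
  ccontinuous_at f p -> slit_plane (f p) -> {for p, continuous (fun y => arg (f y))}.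
Proof.
move=> [f1 f2] /slit_plane_gt0 p0.
have cn : {for p, continuous (fun y => modulus (f y))}.
  apply: (@continuous_comp _ _ _
    (fun y => complex.Re (f y) ^+ 2 + complex.Im (f y) ^+ 2) Num.sqrt).
    by apply: (@continuousD _ R^o); exact: continuousM.
  exact: sqrt_continuous.
apply: (@continuousM _ _ (cst 2)); first exact: cst_continuous.
apply: (@continuous_comp _ _ _
  (fun y => complex.Im (f y) / (modulus (f y) + complex.Re (f y))) (@atan R)).
  apply: continuousM => //; apply: continuousV; first exact: lt0r_neq0.
  exact: (@continuousD _ R^o).
exact: continuous_atan.
Qed.

Lemma arg_bound z : - pi < arg z < pi.
Proof.
have := atan_gtNpi2 (complex.Im z / (modulus z + complex.Re z)).
have := atan_ltpi2 (complex.Im z / (modulus z + complex.Re z)).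
by rewrite /arg; lra.
Qed.

Lemma arg_gt0 z : 0 < complex.Im z -> 0 < arg z.
Proof.
move=> z0; have /slit_plane_gt0 p0 : slit_plane z by rewrite /slit_plane gt_eqF.
by rewrite /arg mulr_gt0// -[X in X < _](@atan0 R) lt_atan// divr_gt0.
Qed.

Lemma arg_lt0 z : complex.Im z < 0 -> arg z < 0.
Proof.
move=> z0; have /slit_plane_gt0 p0 : slit_plane z by rewrite /slit_plane lt_eqF.
rewrite /arg pmulr_rlt0// -[X in _ < X](@atan0 R) lt_atan//.
by rewrite pmulr_llt0// invr_gt0.
Qed.

Lemma slit_plane_Im z : complex.Im z != 0 -> slit_plane z.
Proof. by rewrite /slit_plane => ->. Qed.

Lemma arg_opp_gt0 z : 0 < complex.Im z -> arg (- z) = arg z - pi.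
Proof.
move=> z0; have sz : slit_plane z by rewrite slit_plane_Im// gt_eqF.
have Nz0 : complex.Im (- z) < 0 by case: z z0 {sz} => a b /=; rewrite oppr_lt0.
have sNz : slit_plane (- z) by rewrite slit_plane_Im// lt_eqF.
have := is_arg_uniq (is_argN (is_arg_arg sNz)) (is_arg_arg sz).
move: (arg_bound z) (arg_bound (- z)) (arg_gt0 z0) (arg_lt0 Nz0) => b1 b2 b3 b4.
move=> /cis_eq1; rewrite ltr_norml => h.
by suff : arg (- z) + pi - arg z = 0; [lra|apply: h; lra].
Qed.

Lemma arg_opp_lt0 z : complex.Im z < 0 -> arg (- z) = arg z + pi.
Proof.
move=> z0; have := @arg_opp_gt0 (- z); rewrite opprK => -> //; first by rewrite subrK.
by case: z z0 => a b /=; rewrite oppr_gt0.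
Qed.

(** A continuous argument of the constant 1 takes its values in the multiples of
    2 pi; if it were not constant then, by the intermediate value theorem, two
    of its values would be at distance at most pi. *)
Lemma cis_const (g : R -> R) (a b : R) : a <= b -> {within `[a, b], continuous g} ->
  (forall t, t \in `[a, b] -> cis (g t) = 1) -> g a = g b.
Proof.
move=> ab cg g1.
have ga : cis (g a) = 1 by apply: g1; rewrite in_itv/= lexx.
have gb : cis (g b) = 1 by apply: g1; rewrite in_itv/= lexx andbT.
have step (x y : R) : x < y -> cis x = 1 ->
    (forall v, x <= v <= y -> exists2 c, c \in `[a, b] & g c = v) -> False.
  move=> xy x1 h; have xm : x < Num.min y (x + pi).
    by rewrite lt_min xy ltrDl pi_gt0.
  (* the cap at pi keeps the distance to x below 2 pi *)
  have [|c cab gc] := h (Num.min y (x + pi)).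
    by rewrite (ltW xm) ge_min lexx.
  have : cis (g c - x) = 1.
    by rewrite cisD g1// mul1r -[LHS]mulr1 -x1 cisNK.
  move=> /cis_eq1; rewrite gc => e.
  have mp : Num.min y (x + pi) <= x + pi by rewrite ge_min lexx orbT.
  have := pi_gt0 R => pi0; have : Num.min y (x + pi) - x = 0.
    by apply: e; rewrite gtr0_norm; lra.
  lra.
have [l|l|//] := ltgtP (g a) (g b).
  exfalso; apply: (step _ _ l ga) => v /andP[v1 v2].
  by apply: (IVT ab cg); rewrite (min_idPl (ltW l)) (max_idPr (ltW l)) v1.
exfalso; apply: (step _ _ l gb) => v /andP[v1 v2].
by apply: (IVT ab cg); rewrite (min_idPr (ltW l)) (max_idPl (ltW l)) v1.
Qed.

(** A relation between F and d rather than a function of F, so that no continuous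
    argument has to be chosen; d is unique by [arg_increment_uniq]. *)
Definition arg_increment (F : R -> R[i]) (d : R) := exists g : R -> R,
  [/\ {within `[0, 1], continuous g},
      forall t, t \in `[0, 1] -> is_arg (F t) (g t) & g 1 - g 0 = d].

Lemma arg_increment_uniq F d d' : arg_increment F d -> arg_increment F d' -> d = d'.
Proof.
move=> [g [cg Fg <-]] [h [ch Fh <-]].
have c : {within `[0, 1], continuous (fun t => g t - h t)}.
  by move=> t; apply: (@continuousB _ R^o); [exact: cg|exact: ch].
have := cis_const ler01 c (fun t t01 => is_arg_uniq (Fg t t01) (Fh t t01)).
lra.
Qed.

Lemma arg_increment_slit (F : R -> R[i]) : (forall t, ccontinuous_at F t) ->
  (forall t, t \in `[0, 1] -> slit_plane (F t)) ->
  arg_increment F (arg (F 1) - arg (F 0)).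
Proof.
move=> cF sF; exists (fun t => arg (F t)); split => //.
  apply/continuous_in_subspaceT => t /set_mem t01; apply: arg_continuous => //.
  exact: sF.
by move=> t /sF /is_arg_arg.
Qed.

(** A path that goes once through the cut, from below to above, turns clockwise
    there: the principal argument jumps by 2 pi, which the continuous argument
    does not see.  The argument of - F, shifted by pi, is continuous along the
    path. *)
Lemma arg_increment_cross (F : R -> R[i]) : (forall t, ccontinuous_at F t) ->
  (forall t, t \in `[0, 1] -> slit_plane (- F t)) ->
  complex.Im (F 0) < 0 -> 0 < complex.Im (F 1) ->
  arg_increment F (arg (F 1) - arg (F 0) - pi *+ 2).
Proof.
move=> cF sF F0 F1; exists (fun t => arg (- F t) + pi); split => //.
- apply/continuous_in_subspaceT => t /set_mem t01.
  apply: (@continuousD _ R^o _ (fun t => arg (- F t)) (cst pi)).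
    2: exact: cst_continuous.
  apply: arg_continuous; last exact: sF.
  have := ccontinuousM (ccontinuous_cst (-1) t) (cF t).
  by under [X in ccontinuous_at X _ -> _]funext do rewrite mulN1r.
- by move=> t /sF /is_arg_arg/is_argN.
- by rewrite (arg_opp_lt0 F0) (arg_opp_gt0 F1) mulr2n; lra.
Qed.

Lemma arg_incrementM F G d d' : arg_increment F d -> arg_increment G d' ->
  arg_increment (fun t => F t * G t) (d + d').
Proof.
move=> [g [cg Fg <-]] [h [ch Gh <-]]; exists (fun t => g t + h t); split.
- by move=> t; apply: (@continuousD _ R^o); [exact: cg|exact: ch].
- by move=> t t01; apply: is_argM; [exact: Fg|exact: Gh].
- by ring.
Qed.

Lemma arg_increment_prod (I : Type) (r : seq I) (P : pred I)
    (F : I -> R -> R[i]) (d : I -> R) :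
  (forall i, P i -> arg_increment (F i) (d i)) ->
  arg_increment (fun t => \prod_(i <- r | P i) F i t) (\sum_(i <- r | P i) d i).
Proof.
move=> Fd; elim: r => [|i r [g [cg Fg gd]]].
  exists (fun=> 0); split; first by move=> t; exact: cst_continuous.
    by move=> t _; rewrite big_nil; exact: (@is_arg_pos _ 1).
  by rewrite big_nil subrr.
have [Pi|Pi] := boolP (P i); last first.
  exists g; split; rewrite ?big_cons ?(negbTE Pi)//.
  by move=> t /Fg; rewrite big_cons (negbTE Pi).
have [h [ch Fh hd]] := Fd _ Pi.
exists (fun t => h t + g t); split.
- by move=> t; apply: (@continuousD _ R^o); [exact: ch|exact: cg].
- by move=> t t01; rewrite big_cons Pi; apply: is_argM; [exact: Fh|exact: Fg].
- by rewrite big_cons Pi -hd -gd; ring.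
Qed.

End ArgIncrement.

(** * Continuous logarithms on cubes and spheres *)

Section Log.
Variable R : realType.

Definition unimodular (z : R[i]) := complex.Re z ^+ 2 + complex.Im z ^+ 2 = 1.

Lemma unimodular_cis_arg z : unimodular z -> slit_plane z -> z = cis (arg z).
Proof.
move=> z1 /is_arg_arg[r r0 e]; rewrite {1}e.
suff -> : r = 1 by rewrite mul1r.
move: z1; rewrite e /unimodular /= !mul0r subr0 addr0 !exprMn -mulrDr cos2Dsin2 mulr1.
by move=> /eqP; rewrite sqrf_eq1 => /orP[|]/eqP // r1; move: r0; rewrite r1 ltr0N1.
Qed.

Lemma unimodular_cis t : unimodular (cis t).
Proof. exact: cos2Dsin2. Qed.

Lemma unimodularM z w : unimodular z -> unimodular w -> unimodular (z * w).
Proof.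
by case: z w => a b [c d]; rewrite /unimodular /= => h k; rewrite -[RHS]mulr1 -{1}h -k;
  ring.
Qed.

Lemma unimodular_exists_cis z : unimodular z -> exists t, z = cis t.
Proof.
move=> z1; have [sz|] := boolP (slit_plane z).
  by exists (arg z); exact: unimodular_cis_arg.
rewrite /slit_plane negb_or negbK -leNgt => /andP[/eqP z0 zl]; exists pi; rewrite cis_pi.
move: z1 z0 zl; case: z => a b /=; rewrite /unimodular /= => + b0;
  rewrite b0 expr0n addr0.
move=> /eqP; rewrite sqrf_eq1 => /orP[|]/eqP ->; rewrite ?ler10// => _.
by apply/eqP; rewrite eq_complex /= oppr0 !eqxx.
Qed.

Lemma unimodular_close (z w v : R[i]) : unimodular z -> unimodular w ->
  `|complex.Re z - complex.Re v| < 1/2 -> `|complex.Im z - complex.Im v| < 1/2 ->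
  `|complex.Re w - complex.Re v| < 1/2 -> `|complex.Im w - complex.Im v| < 1/2 ->
  slit_plane (z * w^*).
Proof.
case: z w v => a b [c d] [e f]; rewrite /unimodular /= => h k.
rewrite !ltr_norml => /andP[l1 r1] /andP[l2 r2] /andP[l3 r3] /andP[l4 r4].
rewrite /slit_plane; apply/orP; right; rewrite /= mulrN opprK.
have : (a - c) ^+ 2 < 1 by nra.
have : (b - d) ^+ 2 < 1 by nra.
by move: h k; lra.
Qed.

Section star.
Variables (V : normedModType R) (K : set V) (f : V -> R[i]).
Hypotheses (cK : compact K)
  (starK : forall p t, K p -> 0 <= t <= 1 -> K (t *: p))
  (cf : forall p, ccontinuous_at f p) (f1 : forall p, unimodular (f p)).

(** Uniform continuity of f on K, in the form needed to divide nearby values. *)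
Lemma unimodular_heine : exists2 e, 0 < e &
  forall p q, K p -> ball p e q -> slit_plane (f q * (f p)^*).
Proof.
have /compact_near_coveringP/(_ _ (0^'+)
   (fun e p => forall q, ball p e q -> slit_plane (f q * (f p)^*)) _) := cK.
case=> [|e /= e0 he].
  move=> p Kp; have [c1 c2] := cf p.
  have n12 : 0 < 1/2 :> R by lra.
  have [d d0 hd] : exists2 d, 0 < d & forall q, ball p d q ->
     `|complex.Re (f q) - complex.Re (f p)| < 1/2 /\
     `|complex.Im (f q) - complex.Im (f p)| < 1/2.
    have /cvgrPdist_lt/(_ _ n12) k1 := c1; have /cvgrPdist_lt/(_ _ n12) k2 := c2.
    have /nbhs_ballP[d /= d0 hd] : nbhs p (fun q : V =>
        (`|complex.Re (f p) - complex.Re (f q)| < 1/2) /\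
        (`|complex.Im (f p) - complex.Im (f q)| < 1/2)).
      exact: filterI k1 k2.
    by exists d => // q /hd [/= h1 h2]; rewrite distrC h1 distrC h2.
  exists (ball p (d / 2), [set e | 0 < e < d / 2]).
    split => /=; first by apply: nbhsx_ballx; rewrite divr_gt0.
    exists (d / 2); first by rewrite /= divr_gt0.
    by move=> x /= + x0; rewrite sub0r normrN gtr0_norm// x0.
  move=> [p' e] /= [pp' /andP[e0 ed]] q qe.
  have [k1 k2] : `|complex.Re (f p') - complex.Re (f p)| < 1 / 2 /\
     `|complex.Im (f p') - complex.Im (f p)| < 1 / 2.
    by apply/hd/(le_ball _ pp'); lra.
  have [k3 k4] : `|complex.Re (f q) - complex.Re (f p)| < 1 / 2 /\
     `|complex.Im (f q) - complex.Im (f p)| < 1 / 2.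
    apply: hd; rewrite (splitr d); apply: ball_triangle pp' _.
    by apply: le_ball qe; lra.
  exact: (unimodular_close (v := f p)).
exists (e / 2); first by rewrite divr_gt0.
move=> p q Kp pq; apply: (he (e / 2)) pq => //=.
- by rewrite sub0r normrN gtr0_norm ?divr_gt0//; lra.
- by rewrite divr_gt0.
Qed.

(** Cut the segment from 0 to p into N equal parts, N so large that the quotient
    of the values of f at the ends of each part lies in the slit plane, and add
    up the principal arguments of these quotients. *)
Lemma log_star_shaped : exists g : V -> R,
  forall p, K p -> {for p, continuous g} /\ f p = cis (g p).
Proof.
have [e e0 he] := unimodular_heine.
have [M [Mr hM]] := compact_bounded cK.
have M0 : 0 < `|M| + 1 by rewrite ltr_wpDl.
have KM p : K p -> `|p| <= `|M| + 1.
  by move=> /(hM (`|M| + 1)); apply; rewrite (le_lt_trans (ler_norm _))// ltrDl.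
have [N [N0 hN]] : exists N, (0 < N)%N /\ (`|M| + 1) / N%:R < e.
  exists (Num.truncn ((`|M| + 1) / e)).+1; split=> //.
  by rewrite ltr_pdivrMr// mulrC -ltr_pdivrMr// truncnS_gt.
have N0R : 0 < N%:R :> R by rewrite ltr0n.
have [t0 ft0] := unimodular_exists_cis (f1 0).
(* h k p is the quotient of the values of f at the ends of the k-th part *)
pose s k : R := k%:R / N%:R.
pose h k p := f (s k.+1 *: p) * (f (s k *: p))^*.
have sb k : (k <= N)%N -> 0 <= s k <= 1.
  move=> kN; rewrite /s divr_ge0//= ler_pdivrMr// mul1r ler_nat//.
have hs k p : (k < N)%N -> K p -> slit_plane (h k p).
  move=> kN Kp; apply: he; first by apply: starK => //; apply/sb/ltnW.
  rewrite -ball_normE /= -scalerBl normrZ distrC.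
  have -> : s k.+1 - s k = N%:R^-1.
    by rewrite /s -mulrBl -natrB// subSnn mul1r.
  rewrite gtr0_norm ?invr_gt0//; apply: le_lt_trans hN.
  by rewrite mulrC ler_pM2r ?invr_gt0//; exact: KM.
have hu k p : unimodular (h k p).
  apply: unimodularM => //; have := f1 (s k *: p); case: (f _) => a b.
  by rewrite /unimodular /= sqrrN.
have ch k p : ccontinuous_at (h k) p.
  have cs j : ccontinuous_at (fun p => f (s j *: p)) p.
    have [c1 c2] := cf (s j *: p).
    have cz : {for p, continuous (fun p : V => s j *: p)} by exact: scaler_continuous.
    split.
      exact: (@continuous_comp _ _ _ (fun p : V => s j *: p) (fun q => complex.Re (f q))).
    exact: (@continuous_comp _ _ _ (fun p : V => s j *: p) (fun q => complex.Im (f q))).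
  apply: ccontinuousM; first exact: cs.
  by apply: ccontinuous_conj; exact: cs.
exists (fun p => t0 + \sum_(k < N) arg (h k p)) => p Kp; split.
  apply: (@continuousD _ R^o _ (cst t0) (fun p => \sum_(k < N) arg (h k p))).
    exact: cst_continuous.
  apply: (@cvg_big R^o _ _ _ _ (@add_continuous R^o)) => k _.
  by apply: arg_continuous; [exact: ch|exact: hs].
have tel n : (n <= N)%N -> f (s n *: p) = cis (t0 + \sum_(k < n) arg (h k p)).
  elim: n => [|n IH] nN; first by rewrite big_ord0 addr0 /s mul0r scale0r.
  rewrite big_ord_recr/= addrA cisD -IH ?(ltnW nN)// -unimodular_cis_arg//;
    last exact: hs.
  rewrite /h mulrCA; have := f1 (s n *: p); case: (f (s n *: p)) => a b.
  rewrite /unimodular /= => ab; rewrite -[LHS]mulr1; congr (_ * _).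
  apply/eqP; rewrite eq_complex /=; apply/andP; split; apply/eqP; last by ring.
  by rewrite -ab; ring.
by rewrite -tel// /s divff ?scale1r// lt0r_neq0.
Qed.

End star.
End Log.

Section Hemispheres.
Variable R : realType.

Lemma row_continuous (T : topologicalType) n (f : 'I_n -> T -> R) x :
  (forall k, {for x, continuous (f k)}) ->
  {for x, continuous (fun y => \row_k f k y : 'rV[R]_n)}.
Proof.
move=> cf; apply/cvg_ballP => e e0.
have h : \forall y \near x, forall k, ball (f k x) e (f k y).
  by apply: filter_forall => k; have /cvg_ballP/(_ _ e0) := cf k.
near=> y; split => //= i j; rewrite !mxE.
by have : forall k, ball (f k x) e (f k y) by near: y.
Unshelve. all: by end_near. Qed.

Lemma pt3_continuous (T : topologicalType) (f g h : T -> R) x :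
  {for x, continuous f} -> {for x, continuous g} -> {for x, continuous h} ->
  {for x, continuous (fun y => pt3 (f y) (g y) (h y))}.
Proof.
move=> cf cg ch; apply: row_continuous => -[[|[|[|]]] //= _].
Qed.

Definition cx (p : 'rV[R]_3) : R := p ord0 ord0.
Definition cy (p : 'rV[R]_3) : R := p ord0 (lift ord0 ord0).
Definition cz (p : 'rV[R]_3) : R := p ord0 ord_max.

Lemma cx_continuous : continuous cx. Proof. exact: coord_continuous. Qed.
Lemma cy_continuous : continuous cy. Proof. exact: coord_continuous. Qed.
Lemma cz_continuous : continuous cz. Proof. exact: coord_continuous. Qed.

Lemma pt3E p : p = pt3 (cx p) (cy p) (cz p).
Proof.
apply/rowP => k; rewrite mxE; case: k => -[|[|[|//]]] /= h.
- by congr (p _ _); apply/val_inj.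
- by congr (p _ _); apply/val_inj.
- by congr (p _ _); apply/val_inj.
Qed.

Lemma cx_pt3 x y z : cx (pt3 x y z) = x. Proof. by rewrite /cx mxE. Qed.
Lemma cy_pt3 x y z : cy (pt3 x y z) = y. Proof. by rewrite /cy mxE. Qed.
Lemma cz_pt3 x y z : cz (pt3 x y z) = z. Proof. by rewrite /cz mxE. Qed.

Lemma sphere2E p : sphere2 p <-> cx p ^+ 2 + cy p ^+ 2 + cz p ^+ 2 = 1 :> R.
Proof.
rewrite /sphere2 /= 3!big_ord_recl big_ord0 addr0 addrA.
have -> : lift ord0 (lift ord0 (ord0 : 'I_1)) = ord_max :> 'I_3 by apply/val_inj.
by [].
Qed.

Lemma sphere2_norm (p : 'rV[R]_3) : sphere2 p -> `|p| <= 1.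
Proof.
move=> /sphere2E p1; rewrite [leLHS]/Num.norm /= mx_normrE.
apply/bigmax_leP; split=> [|[i k] _ /=]; first exact: ler01.
rewrite ler_norml (ord1 i).
have : p ord0 k ^+ 2 <= 1.
  rewrite -p1 (pt3E p) mxE !(cx_pt3, cy_pt3, cz_pt3).
  by case: k => -[|[|[|//]]] /= _; nra.
by move: (p ord0 k) => a a1; apply/andP; split; nra.
Qed.

Lemma sqnorm_continuous : continuous (fun p => cx p ^+ 2 + cy p ^+ 2 + cz p ^+ 2).
Proof.
move=> p; have x2 := continuousM (@cx_continuous p) (@cx_continuous p).
have y2 := continuousM (@cy_continuous p) (@cy_continuous p).
have z2 := continuousM (@cz_continuous p) (@cz_continuous p).
by apply: continuous_add => //; exact: continuous_add.
Qed.

Lemma sphere2_compact : compact (@sphere2 R).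
Proof.
apply: bounded_closed_compact.
  exists 1; split; first exact: num_real.
  by move=> M M1 p /sphere2_norm p1 /=; apply: le_trans p1 (ltW M1).
rewrite (_ : @sphere2 R = (fun p => cx p ^+ 2 + cy p ^+ 2 + cz p ^+ 2) @^-1` [set 1]).
  apply: (preimage_closed (D := [set x : R | x = 1])) (@closed_eq _ _) => p _.
  exact: sqnorm_continuous.
by apply/seteqP; split => p /sphere2E.
Qed.

Lemma within_comp_range (T U V : topologicalType) (A : set U) (m : T -> U) (h : U -> V) :
  {within A, continuous h} -> continuous m -> (forall x, A (m x)) ->
  continuous (h \o m).
Proof.
move=> /subspace_continuousP ch cm Am x B hB.
have h1 : nbhs (m x) [set y | A y -> B (h y)] := ch _ (Am x) _ hB.
have h2 : nbhs x (m @^-1` [set y | A y -> B (h y)]) := cm x _ h1.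
suff : nbhs x ((h \o m) @^-1` B) by [].
by apply: filterS h2 => y /=; apply.
Qed.

Lemma within_comp (T U V : topologicalType) (A : set T) (B : set U)
    (m : T -> U) (h : U -> V) :
  {within B, continuous h} -> {within A, continuous m} -> (forall x, A x -> B (m x)) ->
  {within A, continuous (h \o m)}.
Proof.
move=> /subspace_continuousP ch /subspace_continuousP cm Am.
apply/subspace_continuousP => x Ax C hC.
have h1 : nbhs (m x) [set y | B y -> C (h y)] := ch _ (Am _ Ax) _ hC.
have h2 : nbhs x [set y | A y -> B (m y) -> C (h (m y))] := cm x Ax _ h1.
suff : nbhs x [set y | A y -> C (h (m y))] by [].
by apply: filterS h2 => y /= h2 Ay; apply: h2 => //; exact: Am.
Qed.

(** Equal to the absolute height on the sphere, and positive wherever the two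
    other coordinates vanish, so that normalisation is possible everywhere. *)
Definition hemi_height (p : 'rV[R]_3) :=
  `|cz p| + Num.max 0 (1 - (cx p ^+ 2 + cy p ^+ 2 + cz p ^+ 2)).

Definition hemi_norm p := Num.sqrt (cx p ^+ 2 + cy p ^+ 2 + hemi_height p ^+ 2).

(** A continuous map from space to the hemisphere of sign s, whose restriction to
    that hemisphere is the identity ([hemi_id]).  With it, a function on the
    hemisphere can be treated as a function on space. *)
Definition hemi (s : R) p :=
  pt3 (cx p / hemi_norm p) (cy p / hemi_norm p) (s * hemi_height p / hemi_norm p).

Lemma hemi_height_continuous : continuous hemi_height.
Proof.
move=> p.
apply: continuous_add.
  apply: (@continuous_comp _ _ _ cz (fun x : R^o => `|x|)); first exact: cz_continuous.
  exact: norm_continuous.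
apply: continuous_max; first exact: cst_continuous.
apply: continuous_sub; first exact: cst_continuous.
exact: sqnorm_continuous.
Qed.

Lemma hemi_norm_sqr p : hemi_norm p ^+ 2 = cx p ^+ 2 + cy p ^+ 2 + hemi_height p ^+ 2.
Proof. by rewrite sqr_sqrtr// !addr_ge0// sqr_ge0. Qed.

Lemma hemi_norm_gt0 p : 0 < hemi_norm p.
Proof.
rewrite sqrtr_gt0 lt_def !addr_ge0 ?sqr_ge0// andbT; apply/eqP => e.
set a := 1 - (cx p ^+ 2 + cy p ^+ 2 + cz p ^+ 2).
have m0 : 0 <= Num.max 0 a by rewrite le_max lexx.
have m1 : a <= Num.max 0 a by rewrite le_max lexx orbT.
have n0 := normr_ge0 (cz p).
have h0 : hemi_height p ^+ 2 = 0.
  by have := sqr_ge0 (cx p); have := sqr_ge0 (cy p); have := sqr_ge0 (hemi_height p); lra.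
have c0 : cx p ^+ 2 + cy p ^+ 2 = 0 by lra.
move: h0 => /eqP; rewrite sqrf_eq0 /hemi_height => /eqP h0.
have /eqP : `|cz p| = 0 by lra.
rewrite normr_eq0 => /eqP z0; move: m1 h0; rewrite -/a /a c0 z0 normr0 expr0n /=; lra.
Qed.

Lemma hemi_norm_continuous : continuous hemi_norm.
Proof.
move=> p; have x2 := continuousM (@cx_continuous p) (@cx_continuous p).
have y2 := continuousM (@cy_continuous p) (@cy_continuous p).
have z2 := continuousM (@hemi_height_continuous p) (@hemi_height_continuous p).
apply: (@continuous_comp _ _ _
  (fun p => cx p ^+ 2 + cy p ^+ 2 + hemi_height p ^+ 2) Num.sqrt);
    last exact: sqrt_continuous.
by apply: continuous_add => //; exact: continuous_add.
Qed.

Lemma hemi_continuous s : continuous (hemi s).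
Proof.
move=> p; have nV : {for p, continuous (fun p => (hemi_norm p)^-1)}.
  by apply: continuousV; [exact/lt0r_neq0/hemi_norm_gt0|exact: hemi_norm_continuous].
apply: (@pt3_continuous _ (fun p => cx p / hemi_norm p)
  (fun p => cy p / hemi_norm p) (fun p => s * hemi_height p / hemi_norm p)).
- exact: continuousM (@cx_continuous p) nV.
- exact: continuousM (@cy_continuous p) nV.
- apply: (continuousM (s := fun p => s * hemi_height p)) => //.
  apply: (continuousM (s := cst s)) (@hemi_height_continuous p).
  exact: cst_continuous.
Qed.

Lemma hemi_sphere s p : s ^+ 2 = 1 -> sphere2 (hemi s p).
Proof.
move=> s2; apply/sphere2E; rewrite cx_pt3 cy_pt3 cz_pt3 !expr_div_n exprMn s2 mul1r.
rewrite -!mulrDl -hemi_norm_sqr divff// sqrf_eq0; exact/lt0r_neq0/hemi_norm_gt0.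
Qed.

Lemma hemi_id s p : s ^+ 2 = 1 -> sphere2 p -> 0 <= s * cz p -> hemi s p = p.
Proof.
move=> s2 /sphere2E p1 sp.
have h : hemi_height p = s * cz p.
  rewrite /hemi_height p1 subrr maxxx addr0 -[in RHS](ger0_norm sp) normrM.
  suff -> : `|s| = 1 by rewrite mul1r.
  by apply/eqP; rewrite -(@eqrXn2 _ 2)// ?expr1n ?normr_ge0// -normrX s2 normr1.
have n1 : hemi_norm p = 1 by rewrite /hemi_norm h exprMn s2 mul1r p1 sqrtr1.
by rewrite /hemi n1 !divr1 h mulrA -expr2 s2 mul1r -pt3E.
Qed.

Lemma cube_compact n (r : R) : compact [set p : 'rV[R]_n | `|p| <= r].
Proof.
apply: bounded_closed_compact.
  exists r; split; first exact: num_real.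
  by move=> M rM p /= pr; apply: le_trans pr (ltW rM).
rewrite (_ : [set _ | _] = (fun p : 'rV[R]_n => `|p|) @^-1` [set x | x <= r]) //.
apply: (preimage_closed (D := [set x : R | x <= r])) (@closed_le _ _) => p _.
exact: norm_continuous.
Qed.

Lemma log_cube n (r : R) (f : 'rV[R]_n -> R[i]) :
  (forall p, ccontinuous_at f p) -> (forall p, unimodular (f p)) ->
  exists g : 'rV[R]_n -> R,
    forall p, `|p| <= r -> {for p, continuous g} /\ f p = cis (g p).
Proof.
move=> cf f1; apply: (log_star_shaped (@cube_compact n r)) => //.
move=> p t /= pr /andP[t0 t1]; rewrite normrZ ger0_norm//.
by apply: le_trans pr; rewrite ler_piMl.
Qed.
End Hemispheres.

Section LogSphere.
Variable R : realType.
Implicit Types (S P Q : set 'rV[R]_3) (u : 'rV[R]_3 -> R[i]).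

(** Each closed hemisphere is a retract of space, so u has a logarithm on both.
    On the equator, which is connected, the two logarithms differ by a constant,
    and after a correction by this constant they match. *)
Lemma log_sphere S u : homeomorphic (@sphere2 R) S ->
  (forall p, S p -> ccontinuous_at u p) -> (forall p, S p -> unimodular (u p)) ->
  exists g : 'rV[R]_3 -> R,
    {within S, continuous g} /\ forall p, S p -> u p = cis (g p).
Proof.
move=> [h [g [[hS hinj hsurj] hK ch cg]]] cu u1.
have sS q : sphere2 q -> S (h q) by move=> sq; exact: hS.
have lift s : s ^+ 2 = 1 -> exists t : 'rV[R]_3 -> R,
    forall q, `|q| <= 1 -> {for q, continuous t} /\ u (h (hemi s q)) = cis (t q).
  move=> s2; apply: (@log_cube _ _ 1 (fun q => u (h (hemi s q)))) => q; last first.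
    exact/u1/sS/hemi_sphere.
  apply: (@ccontinuous_comp _ _ _ (h \o hemi s) u); last exact/cu/sS/hemi_sphere.
  apply: (within_comp_range ch) => [|p]; first exact: hemi_continuous.
  exact: hemi_sphere.
have N1 : (-1) ^+ 2 = 1 :> R by rewrite sqrrN expr1n.
(* t1 and t2 are the logarithms on the upper and on the lower hemisphere *)
have [t1 t1P] := lift 1 (expr1n _ _).
have [t2 t2P] := lift (-1) N1.
have t1E q : sphere2 q -> 0 <= cz q -> u (h q) = cis (t1 q).
  move=> sq z0; have [_ <-] := t1P q (sphere2_norm sq).
  by rewrite hemi_id ?expr1n ?mul1r.
have t2E q : sphere2 q -> cz q <= 0 -> u (h q) = cis (t2 q).
  move=> sq z0; have [_ <-] := t2P q (sphere2_norm sq).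
  by rewrite hemi_id// mulN1r oppr_ge0.
pose e a : 'rV[R]_3 := pt3 (cos a) (sin a) 0.
have se a : sphere2 (e a).
  by apply/sphere2E; rewrite cx_pt3 cy_pt3 cz_pt3 expr0n addr0 cos2Dsin2.
have ze a : cz (e a) = 0 by rewrite cz_pt3.
pose c := t1 (e 0) - t2 (e 0).
have d1 a : cis (t1 (e a) - t2 (e a)) = 1.
  by rewrite cisD -t1E ?ze// t2E ?ze// mulrC cisNK.
(* run along the equator from (1, 0, 0) to q *)
have eqt q : sphere2 q -> cz q = 0 -> t1 q = t2 q + c.
  move=> sq zq; have [a qa] : exists a, q = e a.
    have /unimodular_exists_cis[a] : unimodular (cx q +i* cy q).
      by rewrite /unimodular/=; move/sphere2E: sq; rewrite zq expr0n addr0.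
    by case=> xa ya; exists a; rewrite (pt3E q) xa ya zq.
  have ce : continuous (fun t : R => e (t * a)).
    move=> t; have ca : {for t, continuous (fun t : R => t * a)}.
      by apply: continuousM; [exact: cvg_id|exact: cst_continuous].
    apply: (@pt3_continuous _ _ (fun t : R => cos (t * a))
      (fun t : R => sin (t * a)) (cst 0)).
    - exact: continuous_comp ca (@continuous_cos _ _).
    - exact: continuous_comp ca (@continuous_sin _ _).
    - exact: cst_continuous.
  pose k (t : R) := t1 (e (t * a)) - t2 (e (t * a)).
  have ck : {within `[0, 1], continuous k}.
    apply: continuous_subspaceT => t; apply: continuous_sub.
      have [c1 _] := t1P _ (sphere2_norm (se (t * a))).
      by apply: (@continuous_comp _ _ _ (fun t : R => e (t * a)) t1 t); [exact: ce|].
    have [c2 _] := t2P _ (sphere2_norm (se (t * a))).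
    by apply: (@continuous_comp _ _ _ (fun t : R => e (t * a)) t2 t); [exact: ce|].
  have := cis_const ler01 ck (fun t _ => d1 (t * a)).
  by rewrite /k mul0r mul1r -qa /c; lra.
have c1 : cis c = 1 by exact: d1.
pose t q := if 0 <= cz q then t1 q else t2 q + c.
have ct : {within @sphere2 R, continuous t}.
  pose A := [set q : 'rV[R]_3 | 0 <= cz q]; pose B := [set q : 'rV[R]_3 | cz q <= 0].
  have -> : @sphere2 R = (@sphere2 R `&` A) `|` (@sphere2 R `&` B).
    rewrite -setIUr; apply/seteqP; split => [q sq|q []//]; split => //.
    by have [z0|/ltW z0] := leP 0 (cz q); [left|right].
  have cS : closed (@sphere2 R).
    by apply: compact_closed; [exact: norm_hausdorff|exact: sphere2_compact].
  apply: withinU_continuous.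
  - apply: closedI => //; apply: (preimage_closed (D := [set x : R | 0 <= x])) => [p _|].
      exact: cz_continuous.
    exact: closed_ge.
  - apply: closedI => //; apply: (preimage_closed (D := [set x : R | x <= 0])) => [p _|].
      exact: cz_continuous.
    exact: closed_le.
  - apply: (@subspace_eq_continuous _ _ _ t1).
      by move=> q /set_mem[_ zq]; rewrite /from_subspace /t ifT.
    apply: continuous_in_subspaceT => q /set_mem[sq _].
    by have [] := t1P _ (sphere2_norm sq).
  - apply: (@subspace_eq_continuous _ _ _ (fun q => t2 q + c)).
      move=> q /set_mem[sq zq]; rewrite /from_subspace /t; case: ifP => // z0.
      by rewrite eqt//; apply/eqP; rewrite eq_le zq z0.
    apply: continuous_in_subspaceT => q /set_mem[sq _].
    apply: continuous_add; last exact: cst_continuous.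
    by have [] := t2P _ (sphere2_norm sq).
have tE q : sphere2 q -> u (h q) = cis (t q).
  move=> sq; rewrite /t; case: ifPn => [/t1E->//|]; rewrite -ltNge => /ltW z0.
  by rewrite t2E// cisD c1 mulr1.
have gS p : S p -> sphere2 (g p) /\ h (g p) = p.
  move=> /hsurj[q sq <-]; have gq : g (h q) = q by apply: hK; exact/mem_set.
  by rewrite gq.
exists (t \o g); split; first by apply: within_comp ct cg _ => p /gS[].
by move=> p /gS[sg gp]; rewrite /= -tE// gp.
Qed.

Lemma embedded_sphere_compact S : homeomorphic (@sphere2 R) S -> compact S.
Proof.
move=> [h [g [[hf _ hs] _ ch _]]]; have -> : S = h @` @sphere2 R.
  by apply/seteqP; split; [exact: hs|move=> _ [q sq <-]; exact: hf].
exact: continuous_compact ch (@sphere2_compact R).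
Qed.

Lemma embedded_sphere_closed S : homeomorphic (@sphere2 R) S -> closed S.
Proof.
by move=> /embedded_sphere_compact; apply: compact_closed; exact: norm_hausdorff.
Qed.

(** The side Q may contain points where u is not defined as a circle-valued map;
    it is removed by gluing.  With t the extension to space of a logarithm of u
    on S, the map equal to u cis (- t) on P and to 1 on Q is continuous on space,
    because u cis (- t) is 1 on S. *)
Lemma log_separated S P Q u (r : R) : homeomorphic (@sphere2 R) S ->
  open P -> open Q -> P `&` Q = set0 -> P `|` Q = ~` S ->
  (forall p, ~ Q p -> ccontinuous_at u p) -> (forall p, ~ Q p -> unimodular (u p)) ->
  exists g : 'rV[R]_3 -> R, forall p, P p -> `|p| <= r ->
    {for p, continuous g} /\ u p = cis (g p).
Proof.
move=> hS oP oQ PQ0 PQS cu u1.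
have cS := embedded_sphere_compact hS; have clS := embedded_sphere_closed hS.
have SQ p : S p -> ~ Q p.
  by move=> Sp Qp; have : (~` S) p by rewrite -PQS; right.
have QS p : ~ Q p -> ~ P p -> S p.
  move=> nQ nP; apply: contrapT => nS.
  by have : (~` S) p by []; rewrite -PQS => -[].
have PQ p : P p -> ~ Q p by move=> Pp Qp; have : (P `&` Q) p by []; rewrite PQ0.
have [t [ct tE]] := log_sphere hS
  (fun p Sp => cu p (SQ p Sp)) (fun p Sp => u1 p (SQ p Sp)).
have [M [Mr hM]] := compact_bounded (continuous_compact ct cS).
have M0 : 0 < `|M| + 1 by rewrite ltr_wpDl.
have tM p : S p -> `|t p| <= `|M| + 1.
  move=> Sp; apply: (hM (`|M| + 1)); last by exists p.
  by rewrite (le_lt_trans (ler_norm _))// ltrDl.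
have [t' [tt' ct' _]] :=
  continuous_bounded_extension (@pseudometric_normal R _) clS M0 ct tM.
pose v p := u p * cis (- t' p).
have cv p : ~ Q p -> ccontinuous_at v p.
  move=> /cu cup; apply: ccontinuousM => //.
  have cN : {for p, continuous (fun p => - t' p)}.
    exact: (@continuousN _ R^o) (ct' p).
  split; [exact: continuous_comp cN (@continuous_cos _ _)|
          exact: continuous_comp cN (@continuous_sin _ _)].
have v1 p : S p -> v p = 1.
  by move=> Sp; rewrite /v tE// -tt' ?inE// mulrC cisNK.
(* outside Q the two formulas for psi agree because v is 1 on S *)
pose psi p := if `[< P p >] then v p else 1.
have psiE p : ~ Q p -> v p = psi p.
  by move=> nQ; rewrite /psi; case: asboolP => // nP; rewrite v1//; exact: QS.
have psi1 p : ~ P p -> 1 = psi p by move=> nP; rewrite /psi; case: asboolP.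
have cpsi : forall p, ccontinuous_at psi p.
  have aux (pr : R[i] -> R) :
      (forall p, ~ Q p -> {for p, continuous (fun y => pr (v y))}) ->
      continuous (fun y => pr (psi y)).
    move=> cpr; apply/continuous_subspace_setT.
    have -> : [set: 'rV[R]_3] = ~` Q `|` ~` P.
      apply/seteqP; split => // p _; have [Pp|nP] := pselect (P p).
        by left; exact: PQ.
      by right.
    apply: withinU_continuous; [exact: open_closedC|exact: open_closedC| |].
      apply: (@subspace_eq_continuous _ _ _ (fun y => pr (v y))).
        by move=> p /set_mem nQ; rewrite /from_subspace psiE.
      by apply: continuous_in_subspaceT => p /set_mem; exact: cpr.
    apply: (@subspace_eq_continuous _ _ _ (fun y => pr 1)).
      by move=> p /set_mem nP; rewrite /from_subspace -psi1.
    by apply: continuous_subspaceT => p; exact: cst_continuous.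
  move=> p; split; first by apply: aux => q /cv[].
  by apply: aux => q /cv[].
have upsi p : unimodular (psi p).
  rewrite /psi; case: asboolP => [Pp|_].
    by apply: unimodularM; [exact/u1/PQ|exact: unimodular_cis].
  by rewrite /unimodular /= expr1n expr0n addr0.
have [eta etaP] := log_cube r cpsi upsi.
exists (fun p => eta p + t' p) => p Pp pr; have [ce pe] := etaP p pr.
split; first by apply: continuous_add => //; exact: ct'.
rewrite cisD -pe -psiE; last exact: PQ.
by rewrite /v -mulrA cisNK mulr1.
Qed.
End LogSphere.

(** * A complex function whose zero set is a sublink *)

Section Spinor.
Variable R : realType.
Implicit Types (x y z : R).

Definition enorm x y z := Num.sqrt (x ^+ 2 + y ^+ 2 + z ^+ 2).

Lemma enorm_ge0 x y z : 0 <= enorm x y z. Proof. exact: sqrtr_ge0. Qed.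

Lemma enorm_sqr x y z : enorm x y z ^+ 2 = x ^+ 2 + y ^+ 2 + z ^+ 2.
Proof. by rewrite sqr_sqrtr// !addr_ge0// sqr_ge0. Qed.

Lemma enorm_ge x y z : - enorm x y z <= z <= enorm x y z.
Proof.
have := enorm_ge0 x y z; have := enorm_sqr x y z; move: (enorm _ _ _) => e e2 e0.
have z2 : z ^+ 2 <= e ^+ 2 by rewrite e2 lerDr addr_ge0// sqr_ge0.
by apply/andP; split; nra.
Qed.

(** The numbers |v| + z and |v| - z are the diagonal entries of |v| + v.sigma.
    The first is zero only if v is zero or points straight down. *)
Definition up x y z := enorm x y z + z.
Definition down x y z := enorm x y z - z.

Lemma up_down x y z : up x y z * down x y z = x ^+ 2 + y ^+ 2.
Proof. by have := enorm_sqr x y z; rewrite /up /down; lra. Qed.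

Lemma up_ge0 x y z : 0 <= up x y z.
Proof. by have := enorm_ge x y z; rewrite /up; lra. Qed.

Lemma down_ge0 x y z : 0 <= down x y z.
Proof. by have := enorm_ge x y z; rewrite /down; lra. Qed.

Lemma up_gt0 x y z : (x != 0) || (y != 0) -> 0 < up x y z.
Proof.
move=> xy; rewrite lt_def up_ge0 andbT; apply/eqP => u0.
have := up_down x y z; rewrite u0 mul0r => e.
have x2 := sqr_ge0 x; have y2 := sqr_ge0 y.
have /eqP : x ^+ 2 = 0 by lra.
have /eqP : y ^+ 2 = 0 by lra.
by rewrite !sqrf_eq0 => /eqP y0 /eqP x0; move: xy; rewrite x0 y0 eqxx.
Qed.

(** The matrix of |v| + v.sigma for v = (x, y, z). *)
Definition pauli_entry x y z (a b : bool) : R[i] :=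
  match a, b with
  | false, false => (up x y z)%:C
  | false, true => x -i* y
  | true, false => x +i* y
  | true, true => (down x y z)%:C
  end.

(** A factorisation that shows that the matrix has rank at most one. *)
Definition spinor_of x y z (s : bool -> R[i]) :=
  forall a b, pauli_entry x y z a b = s a * (s b)^*.

(** The first column of the matrix, rescaled.  It depends continuously on v
    outside the half-line that points straight down. *)
Definition up_spinor x y z (a : bool) : R[i] :=
  (Num.sqrt (up x y z))^-1%:C * (if a then x +i* y else (up x y z)%:C).

Lemma up_spinorP x y z : 0 < up x y z -> spinor_of x y z (up_spinor x y z).
Proof.
move=> u0 a b; rewrite /up_spinor /pauli_entry.
have s0 : Num.sqrt (up x y z) != 0 by rewrite lt0r_neq0// sqrtr_gt0.
have ss : (Num.sqrt (up x y z)) ^- 2 = (up x y z)^-1 by rewrite sqr_sqrtr// ltW.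
have u1 : up x y z != 0 by exact: lt0r_neq0.
have ud := up_down x y z.
move: ss; rewrite -exprVn; set q := (Num.sqrt _)^-1;
  move: (up _ _ _) (down _ _ _) u1 ud => U D u1 ud ss.
have qq e : q * q * e = U^-1 * e by rewrite -expr2 ss.
case: a b => -[]; apply/eqP; rewrite eq_complex /=; apply/andP; split; apply/eqP.
- transitivity (q * q * (x ^+ 2 + y ^+ 2)); last by ring.
  by rewrite qq -ud mulrA mulVf ?mul1r.
- by ring.
- by transitivity (q * q * U * x); [rewrite qq mulVf ?mul1r|ring].
- by transitivity (q * q * U * y); [rewrite qq mulVf ?mul1r|ring].
- by transitivity (q * q * U * x); [rewrite qq mulVf ?mul1r|ring].
- by transitivity (q * q * U * (- y)); [rewrite qq mulVf ?mul1r|ring].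
- by transitivity (q * q * U * U); [rewrite qq mulVf ?mul1r|ring].
- by ring.
Qed.

Lemma spinor_exists x y z : exists s, spinor_of x y z s.
Proof.
have [u0|u0] := ltP 0 (up x y z); first by exists (up_spinor x y z); exact: up_spinorP.
have {}u0 : up x y z = 0 by apply/eqP; rewrite eq_le u0 up_ge0.
have := up_down x y z; rewrite u0 mul0r => e.
have x2 := sqr_ge0 x; have y2 := sqr_ge0 y.
have /eqP : x ^+ 2 = 0 by lra.
have /eqP : y ^+ 2 = 0 by lra.
rewrite !sqrf_eq0 => /eqP y0 /eqP x0.
exists (fun a => if a then (Num.sqrt (down x y z))%:C else 0) => a b.
have d2 : Num.sqrt (down x y z) ^+ 2 = down x y z by rewrite sqr_sqrtr// down_ge0.
move: d2; rewrite /pauli_entry u0 x0 y0; set q := Num.sqrt _; move: (down _ _ _) => D d2.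
by case: a b => -[]; apply/eqP; rewrite eq_complex /=; apply/andP; split; apply/eqP;
  rewrite -?d2; ring.
Qed.

Definition herm (s t : bool -> R[i]) := \sum_(c : bool) (s c)^* * t c.

Lemma hermE s t : herm s t = (s true)^* * t true + (s false)^* * t false.
Proof. by rewrite /herm big_bool. Qed.

(** The squared modulus of the product of two spinors is the trace of the product
    of their matrices, namely twice |v| |v'| + v.v'. *)
Lemma herm_eq0 x y z x' y' z' s s' : spinor_of x y z s -> spinor_of x' y' z' s' ->
  herm s s' = 0 -> enorm x y z * enorm x' y' z' + (x * x' + y * y' + z * z') = 0.
Proof.
move=> sP sP'; rewrite hermE => h0.
have : ((s true)^* * s' true + (s false)^* * s' false) * (s true * (s' true)^* +
  s false * (s' false)^*) = 0.
  by rewrite h0 mul0r.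
have -> : ((s true)^* * s' true + (s false)^* * s' false) * (s true * (s' true)^* +
  s false * (s' false)^*)
  = (s true * (s true)^*) * (s' true * (s' true)^*) +
    (s false * (s true)^*) * (s' true * (s' false)^*) +
    (s true * (s false)^*) * (s' false * (s' true)^*) +
      (s false * (s false)^*) * (s' false * (s' false)^*).
  by ring.
rewrite -!sP -!sP' /= => /(congr1 (@complex.Re R)) /=.
by rewrite /up /down; lra.
Qed.

(** Equality in the Cauchy-Schwarz inequality: two vectors in opposite
    directions have the origin on the segment between their ends. *)
Lemma antipodal x y z x' y' z' :
  enorm x y z * enorm x' y' z' + (x * x' + y * y' + z * z') = 0 ->
  exists2 t, 0 <= t <= 1 & [/\ (1 - t) * x + t * x' = 0,
    (1 - t) * y + t * y' = 0 & (1 - t) * z + t * z' = 0].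
Proof.
have e2 := enorm_sqr x y z; have e2' := enorm_sqr x' y' z'.
have e0 := enorm_ge0 x y z; have e0' := enorm_ge0 x' y' z'.
move: (enorm x y z) (enorm x' y' z') e2 e2' e0 e0' => m m' e2 e2' e0 e0' h.
have [s0|s0] := eqVneq (m + m') 0.
  have m0 : m = 0 by lra.
  exists 0; first by rewrite lexx ler01.
  have := sqr_ge0 x; have := sqr_ge0 y; have := sqr_ge0 z; move: e2;
    rewrite m0 expr0n /= => e2 z2 y2 x2.
  have /eqP : x ^+ 2 = 0 by lra.
  have /eqP : y ^+ 2 = 0 by lra.
  have /eqP : z ^+ 2 = 0 by lra.
  by rewrite !sqrf_eq0 => /eqP -> /eqP -> /eqP ->; split; ring.
have sp : 0 < m + m' by rewrite lt_def s0 addr_ge0.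
have sum0 : (m' * x + m * x') ^+ 2 + (m' * y + m * y') ^+ 2 + (m' * z + m * z') ^+ 2 = 0.
  transitivity (m' ^+ 2 * (x ^+ 2 + y ^+ 2 + z ^+ 2) +
      m ^+ 2 * (x' ^+ 2 + y' ^+ 2 + z' ^+ 2) +
      2 * (m * m') * (x * x' + y * y' + z * z')); first by ring.
  rewrite -e2 -e2'; transitivity (2 * (m * m') * (m * m' + (x * x' + y * y' + z * z')));
    first by ring.
  by rewrite h mulr0.
have x2 := sqr_ge0 (m' * x + m * x'); have y2 := sqr_ge0 (m' * y + m * y').
have z2 := sqr_ge0 (m' * z + m * z').
have /eqP : (m' * x + m * x') ^+ 2 = 0 by lra.
have /eqP : (m' * y + m * y') ^+ 2 = 0 by lra.
have /eqP : (m' * z + m * z') ^+ 2 = 0 by lra.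
rewrite !sqrf_eq0 => /eqP z1 /eqP y1 /eqP x1.
exists (m / (m + m')).
  by rewrite (divr_ge0 e0 (ltW sp)) ler_pdivrMr// mul1r lerDl.
have k a a' : (1 - m / (m + m')) * a + m / (m + m') * a' = (m' * a + m * a') / (m + m').
  by field.
by rewrite !k x1 y1 z1 mul0r.
Qed.

End Spinor.

Section CyclicTrace.
Variables (R : realType) (n : nat) (pi : 'S_n) (B : {set 'I_n}).
Hypothesis piB : forall i, (pi i \in B) = (i \in B).

Lemma prod_shift (F : 'I_n -> 'I_n -> R[i]) :
  \prod_(i in B) F i (pi i) = \prod_(j in B) F ((pi^-1)%g j) j.
Proof.
rewrite (reindex_inj (@perm_inj _ (pi^-1)%g)) /=; apply: eq_big => i.
  by rewrite -piB permKV.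
by rewrite permKV.
Qed.

(** A sum over all s of products along the cycles of pi is a product of traces,
    one for each cycle.  For matrices of rank one the trace of a product is the
    product of the scalar products of consecutive vectors.  Summing over the
    values of s on the complement of B only contributes a power of 2. *)
Lemma cyclic_trace_rank_one (xi eta : 'I_n -> bool -> R[i]) :
  \sum_(s : {ffun 'I_n -> bool}) \prod_(i in B) \sum_(c : bool)
    (xi i (s i) * (xi i c)^*) * (eta i c * (eta i (s (pi i)))^*) =
  2 ^+ #|~: B| * \prod_(i in B) (herm (xi i) (eta i) * herm (eta i) (xi (pi i))).
Proof.
pose H := \prod_(i in B) herm (xi i) (eta i).
pose K j b := if j \in B then (eta ((pi^-1)%g j) b)^* * xi j b else 1.
transitivity (H * \sum_(s : {ffun 'I_n -> bool}) \prod_j K j (s j)).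
  rewrite big_distrr /=; apply: eq_bigr => s _.
  rewrite -big_mkcond big_split /= -(prod_shift (fun i j => (eta i (s j))^*)).
  rewrite -!big_split /=.
  apply: eq_bigr => i _; rewrite /herm mulrA big_distrl /= big_distrl /=.
  by apply: eq_bigr => c _; ring.
rewrite -(bigA_distr_bigA K) big_split /= -/H mulrCA; congr (_ * _).
rewrite (bigID (mem B)) /= mulrC; congr (_ * _).
  rewrite (eq_bigr (fun=> 2)); last first.
    by move=> j jB; rewrite big_bool /K (negbTE jB) /= -mulr2n.
  by rewrite prodr_const; congr (_ ^+ _); apply: eq_card => j; rewrite !inE.
rewrite (prod_shift (fun i j => herm (eta i) (xi j))); apply: eq_bigr => j jB.
by rewrite /herm; apply: eq_bigr => b _; rewrite /K jB.
Qed.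

End CyclicTrace.

Section LinkingMap.
Variables (R : realType) (n : nat) (pi : 'S_n) (B : {set 'I_n}).
Hypothesis der : derangement pi.
Hypothesis piB : forall i, (pi i \in B) = (i \in B).
Implicit Types (i j : 'I_n) (p : 'rV[R]_3).
Local Notation c := (@Defs.coord R n).

Lemma coord_neq i : c (pi i) - c i != 0.
Proof.
by rewrite subr_eq0; move/forallP: der => /(_ i); apply: contra => /eqP/Defs.coord_inj ->.
Qed.

(** If the second coordinate of p is that of the point of parameter t of the i-th
    vertical segment, this is 1 - t.  The straight edge from the corner
    (i, i, 0) to the corner (i, pi i, 1 - t) has height t (1 - t) at parameter t:
    as p moves, its points sweep out the arc of parabola.  When the second
    coordinate of p is pi i, as on the i-th horizontal strand, the value is 0 and
    the second corner is back in its place. *)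
Definition lift_height i p := (c (pi i) - cy p) / (c (pi i) - c i).

Definition start_entry i p :=
  pauli_entry (c i - cx p) (c i - cy p) (- cz p).

Definition turn_entry i p :=
  pauli_entry (c i - cx p) (c (pi i) - cy p) (lift_height i p - cz p).

(** The product, over the cycles of pi in B, of the traces of the product of the
    matrices at the successive corners, written as one sum over the choices s of
    a basis vector at the corners (i, i). *)
Definition linking_map p : R[i] :=
  \sum_(s : {ffun 'I_n -> bool}) \prod_(i in B) \sum_(a : bool)
    start_entry i p (s i) a * turn_entry i p a (s (pi i)).

Lemma pauli_entry_continuous (T : topologicalType) (f g h : T -> R) a b q :
  {for q, continuous f} -> {for q, continuous g} -> {for q, continuous h} ->
  ccontinuous_at (fun t => pauli_entry (f t) (g t) (h t) a b) q.
Proof.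
move=> cf cg ch.
have ce : {for q, continuous (fun t => enorm (f t) (g t) (h t))}.
  apply: (@continuous_comp _ _ _ (fun t => f t ^+ 2 + g t ^+ 2 + h t ^+ 2) Num.sqrt).
    apply: continuous_add; last exact: continuousM.
    by apply: continuous_add; exact: continuousM.
  exact: sqrt_continuous.
have cN : {for q, continuous (fun t => - g t)} by exact: (@continuousN _ R^o).
case: a b => -[]; split => //=; try exact: cst_continuous.
  exact: continuous_sub.
exact: continuous_add.
Qed.

Lemma lift_height_continuous i : continuous (lift_height i).
Proof.
move=> p; apply: (continuousM (s := fun p => c (pi i) - cy p));
  last exact: cst_continuous.
by apply: continuous_sub; [exact: cst_continuous|exact: cy_continuous].
Qed.

Lemma linking_map_continuous p : ccontinuous_at linking_map p.
Proof.
have cX (k : R) : {for p, continuous (fun p => k - cx p)}.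
  by apply: continuous_sub; [exact: cst_continuous|exact: cx_continuous].
have cY (k : R) : {for p, continuous (fun p => k - cy p)}.
  by apply: continuous_sub; [exact: cst_continuous|exact: cy_continuous].
apply: ccontinuous_sum => s _; apply: ccontinuous_prod => i _.
apply: ccontinuous_sum => a _.
apply: ccontinuousM; apply: pauli_entry_continuous => //.
  by apply: (@continuousN _ R^o); exact: cz_continuous.
by apply: continuous_sub; [exact: lift_height_continuous|exact: cz_continuous].
Qed.

Lemma linking_mapE p (xi eta : 'I_n -> bool -> R[i]) :
  (forall i, i \in B -> spinor_of (c i - cx p) (c i - cy p) (- cz p) (xi i)) ->
  (forall i, i \in B ->
     spinor_of (c i - cx p) (c (pi i) - cy p) (lift_height i p - cz p) (eta i)) ->
  linking_map p =
  2 ^+ #|~: B| * \prod_(i in B) (herm (xi i) (eta i) * herm (eta i) (xi (pi i))).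
Proof.
move=> xiP etaP; rewrite -(cyclic_trace_rank_one piB).
apply: eq_bigr => s _; apply: eq_bigr => i iB; apply: eq_bigr => a _.
by rewrite -xiP// -etaP.
Qed.

(** A zero of the product gives a pair of consecutive corners that p sees in
    opposite directions; this puts p on the strand between them. *)
Lemma linking_map_neq0 p :
  (forall i, i \in B -> ~ vertical_strand pi i p /\ ~ horizontal_strand pi i p) ->
  linking_map p != 0.
Proof.
move=> pB.
have [xi xiP] := choice (fun i => spinor_exists (c i - cx p) (c i - cy p) (- cz p)).
have [eta etaP] := choice (fun i =>
  spinor_exists (c i - cx p) (c (pi i) - cy p) (lift_height i p - cz p)).
rewrite (linking_mapE (fun i _ => xiP i) (fun i _ => etaP i)).
rewrite mulf_neq0 ?expf_neq0 ?pnatr_eq0//; apply/prodf_neq0 => i iB.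
have [nv nh] := pB i iB; have d0 := coord_neq i.
apply: mulf_neq0; apply/eqP.
  move=> /(herm_eq0 (xiP i) (etaP i))/antipodal[t t01 [ex ey ez]]; apply: nv.
  exists t => //=; rewrite [p]pt3E /line_path.
  have -> : cx p = c i by lra.
  have ey' : cy p = (1 - t) * c i + t * c (pi i) by lra.
  have el : lift_height i p = 1 - t.
    by rewrite /lift_height ey'; move: (c i) (c (pi i)) d0 => a b d0; field.
  have -> : cz p = t * (1 - t) by move: ez; rewrite el; lra.
  by rewrite ey'.
move=> /(herm_eq0 (etaP i) (xiP (pi i)))/antipodal[t t01 [ex ey ez]]; apply: nh.
exists t => //=; rewrite [p]pt3E /line_path.
have ey' : cy p = c (pi i) by lra.
have el : lift_height i p = 0 by rewrite /lift_height ey' subrr mul0r.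
have -> : cz p = 0 by move: ez; rewrite el; lra.
have -> : cx p = (1 - t) * c i + t * c (pi i) by lra.
by rewrite ey'.
Qed.

(** The scalar product of the two upward spinors, up to a positive factor.  It is
    a negative real exactly when the segment between the ends of the two vectors
    passes straight below the origin. *)
Definition up_pairing (x y z x' y' z' : R) : R[i] :=
  (up x y z * up x' y' z')%:C + (x -i* y) * (x' +i* y').

Lemma herm_up x y z x' y' z' :
  herm (up_spinor x y z) (up_spinor x' y' z') =
  ((Num.sqrt (up x y z))^-1 * (Num.sqrt (up x' y' z'))^-1)%:C * up_pairing x y z x' y' z'.
Proof.
rewrite hermE /up_spinor /up_pairing; move: (Num.sqrt _)^-1 (Num.sqrt _)^-1 => q r.
by apply/eqP; rewrite eq_complex /=; apply/andP; split; apply/eqP; ring.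
Qed.

Definition vertical_factor i p :=
  up_pairing (c i - cx p) (c i - cy p) (- cz p)
         (c i - cx p) (c (pi i) - cy p) (lift_height i p - cz p).

Definition horizontal_factor i p :=
  up_pairing (c i - cx p) (c (pi i) - cy p) (lift_height i p - cz p)
         (c (pi i) - cx p) (c (pi i) - cy p) (- cz p).

(** The upward spinors may be used as soon as p is not straight above or below a
    corner of B.  This holds along all strands of A. *)
Lemma linking_map_factor p :
  (forall i, i \in B -> (c i - cx p != 0) || (c i - cy p != 0)) ->
  (forall i, i \in B -> (c i - cx p != 0) || (c (pi i) - cy p != 0)) ->
  exists2 k : R, 0 < k & linking_map p =
    k%:C * \prod_(i in B) (vertical_factor i p * horizontal_factor i p).
Proof.
move=> h1 h2.
pose s i := up (c i - cx p) (c i - cy p) (- cz p).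
pose t i := up (c i - cx p) (c (pi i) - cy p) (lift_height i p - cz p).
have s0 i : i \in B -> 0 < s i by move=> iB; apply/up_gt0/h1.
have t0 i : i \in B -> 0 < t i by move=> iB; apply/up_gt0/h2.
rewrite (linking_mapE (fun i iB => up_spinorP (s0 i iB))
                      (fun i iB => up_spinorP (t0 i iB))).
exists (2 ^+ #|~: B| * \prod_(i in B) (((Num.sqrt (s i))^-1 * (Num.sqrt (t i))^-1) *
   ((Num.sqrt (t i))^-1 * (Num.sqrt (s (pi i)))^-1))).
  rewrite mulr_gt0 ?exprn_gt0// prodr_gt0// => i iB.
  by rewrite !mulr_gt0 ?invr_gt0 ?sqrtr_gt0 ?s0 ?t0// piB.
rewrite rmorphM rmorphXn /= rmorph_nat -mulrA; congr (_ * _).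
rewrite rmorph_prod -big_split /=; apply: eq_bigr => i iB.
by rewrite !herm_up [in RHS]rmorphM mulrACA.
Qed.

End LinkingMap.

(** * Variation of the argument along the strands *)

Section UpPairing.
Variable R : realType.
Implicit Types (x y z w : R).

Lemma up_pairing_Im x y z x' y' z' :
  complex.Im (up_pairing x y z x' y' z') = x * y' - y * x'.
Proof. by rewrite /up_pairing /=; ring. Qed.

Lemma up_pairing_Re x y z x' y' z' :
  complex.Re (up_pairing x y z x' y' z') = up x y z * up x' y' z' + (x * x' + y * y').
Proof. by rewrite /up_pairing /=; ring. Qed.

(** Here w is the length of the horizontal part of the vector. *)
Lemma up_gt_norm x y z w : 0 < w -> x ^+ 2 + y ^+ 2 = w ^+ 2 -> 0 <= z -> w <= up x y z.
Proof.
move=> w0 e z0; have := up_down x y z; have := down_ge0 x y z; have := up_ge0 x y z.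
have : up x y z - down x y z = 2 * z by rewrite /up /down; ring.
rewrite e; move: (up x y z) (down x y z) => u d *; rewrite leNgt; apply/negP => uw; nra.
Qed.

Lemma up_gt_norm_strict x y z w : 0 < w -> x ^+ 2 + y ^+ 2 = w ^+ 2 -> 0 < z ->
  w < up x y z.
Proof.
move=> w0 e z0; have := up_down x y z; have := down_ge0 x y z; have := up_ge0 x y z.
have : up x y z - down x y z = 2 * z by rewrite /up /down; ring.
rewrite e; move: (up x y z) (down x y z) => u d *; rewrite ltNge; apply/negP => uw; nra.
Qed.

Lemma up_lt_norm x y z w : 0 < w -> x ^+ 2 + y ^+ 2 = w ^+ 2 -> z < 0 -> up x y z < w.
Proof.
move=> w0 e z0; have := up_down x y z; have := down_ge0 x y z; have := up_ge0 x y z.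
have : up x y z - down x y z = 2 * z by rewrite /up /down; ring.
rewrite e; move: (up x y z) (down x y z) => u d *; rewrite ltNge; apply/negP => uw; nra.
Qed.

Lemma slit_up_pairing_Im x y z x' y' z' :
  x * y' - y * x' != 0 -> slit_plane (up_pairing x y z x' y' z').
Proof. by move=> h; apply: slit_plane_Im; rewrite up_pairing_Im. Qed.

Lemma slit_up_pairing_dot x y z x' y' z' :
  0 < x * x' + y * y' -> slit_plane (up_pairing x y z x' y' z').
Proof.
move=> h; rewrite /slit_plane up_pairing_Re; apply/orP; right.
by rewrite ltr_wpDl// mulr_ge0// up_ge0.
Qed.

(** The segment between the ends of the two vectors does not pass below the
    origin. *)
Lemma slit_up_pairing_above x y z x' y' z' : (x != 0) || (y != 0) ->
  (x' != 0) || (y' != 0) ->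
  0 <= z -> 0 < z' -> slit_plane (up_pairing x y z x' y' z').
Proof.
have nz (a b : R) : (a != 0) || (b != 0) -> exists2 w, 0 < w & a ^+ 2 + b ^+ 2 = w ^+ 2.
  move=> ab; exists (Num.sqrt (a ^+ 2 + b ^+ 2)).
    2: by rewrite sqr_sqrtr// addr_ge0// sqr_ge0.
  rewrite sqrtr_gt0 lt_def addr_ge0 ?sqr_ge0// andbT; apply/eqP => e.
  have a2 := sqr_ge0 a; have b2 := sqr_ge0 b.
  have /eqP : a ^+ 2 = 0 by lra.
  have /eqP : b ^+ 2 = 0 by lra.
  by rewrite !sqrf_eq0 => /eqP b0 /eqP a0; move: ab; rewrite a0 b0 eqxx.
move=> /nz[w w0 we] /nz[w' w0' we'] z0 z0'.
have h := up_gt_norm w0 we z0; have h' := up_gt_norm_strict w0' we' z0'.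
rewrite /slit_plane up_pairing_Re; apply/orP; right.
have ww : w * w' < up x y z * up x' y' z' by nra.
have : (x * x' + y * y') ^+ 2 <= (w * w') ^+ 2.
  rewrite exprMn -we -we'; have := sqr_ge0 (x * y' - y * x'); lra.
have wp : 0 < w * w' by exact: mulr_gt0.
nra.
Qed.

End UpPairing.

Section Factors.
Variables (R : realType).
Implicit Types a b h z t : R.

(** A horizontal strand of B seen from a point of a vertical strand of A: the
    argument can only jump where the abscissa a lies between the ends b and b'. *)
Lemma slit_horizontal_side (a b b' y z h : R) : b != b' -> a != b -> a != b' ->
  (y = b' -> 0 < (b - a) * (b' - a)) ->
  slit_plane (up_pairing (b - a) (b' - y) (h - z) (b' - a) (b' - y) (- z)).
Proof.
move=> bb ab ab' hy; have [yb|yb] := eqVneq y b'.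
  by apply: slit_up_pairing_dot; rewrite yb subrr mulr0 addr0 hy.
apply: slit_up_pairing_Im.
rewrite (_ : _ - _ = (b' - y) * (b - b')); last by ring.
by rewrite mulf_neq0// subr_eq0// eq_sym.
Qed.

(** At a passage over the strand, the point of A is strictly higher, so that both
    upward components are smaller than the horizontal lengths and the pairing is
    a negative real. *)
Lemma slit_opp_horizontal (a b b' y z h : R) : b != b' ->
  (y = b' -> [/\ (b - a) * (b' - a) < 0, h = 0 & 0 < z]) ->
  slit_plane (- up_pairing (b - a) (b' - y) (h - z) (b' - a) (b' - y) (- z)).
Proof.
move=> bb hy.
have NE (w : R[i]) :
    (complex.Re (- w) = - complex.Re w) * (complex.Im (- w) = - complex.Im w).
  by case: w.
have [yb|yb] := eqVneq y b'; last first.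
  apply: slit_plane_Im; rewrite NE oppr_eq0 up_pairing_Im.
  rewrite (_ : _ - _ = (b' - y) * (b - b')); last by ring.
  by rewrite mulf_neq0// subr_eq0// eq_sym.
have [neg h0 z0] := hy yb.
rewrite /slit_plane; apply/orP; right; rewrite NE up_pairing_Re yb subrr h0 sub0r mulr0
  addr0.
have zN : - z < 0 by rewrite oppr_lt0.
have n1 : 0 < `|b - a| by rewrite normr_gt0; apply/eqP => e; move: neg; rewrite e; lra.
have n2 : 0 < `|b' - a| by rewrite normr_gt0; apply/eqP => e; move: neg; rewrite e; lra.
have e1 : (b - a) ^+ 2 + 0 ^+ 2 = `|b - a| ^+ 2
  by rewrite expr0n addr0 real_normK ?num_real.
have e2 : (b' - a) ^+ 2 + 0 ^+ 2 = `|b' - a| ^+ 2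
  by rewrite expr0n addr0 real_normK ?num_real.
have u1 := up_lt_norm n1 e1 zN; have u2 := up_lt_norm n2 e2 zN.
have p1 := up_ge0 (b - a) 0 (- z); have p2 := up_ge0 (b' - a) 0 (- z).
have : `|b - a| * `|b' - a| = - ((b - a) * (b' - a)) by rewrite -normrM ltr0_norm.
have : up (b - a) 0 (- z) * up (b' - a) 0 (- z) < `|b - a| * `|b' - a| by nra.
lra.
Qed.

(** A vertical strand of B seen from a point of a horizontal strand of A, which
    is at height 0, hence passes below. *)
Lemma slit_vertical_side (a' b b' x h : R) : b != b' -> a' != b -> a' != b' ->
  (x = b -> (b - a') * (b' - a') < 0 -> 0 < h) ->
  slit_plane (up_pairing (b - x) (b - a') (- 0) (b - x) (b' - a') (h - 0)).
Proof.
move=> bb ab ab' hx; have [xb|xb] := eqVneq x b; last first.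
  apply: slit_up_pairing_Im; rewrite (_ : _ - _ = (b - x) * (b' - b)); last by ring.
  by rewrite mulf_neq0// subr_eq0 eq_sym.
have p0 : (b - a') * (b' - a') != 0 by rewrite mulf_neq0// subr_eq0 eq_sym.
have [pos|neg] := ltP 0 ((b - a') * (b' - a')).
  by apply: slit_up_pairing_dot; rewrite xb subrr mul0r add0r.
apply: slit_up_pairing_above; rewrite ?oppr0 ?addr0 ?lexx//.
- by rewrite !subr_eq0 [b == a']eq_sym ab orbT.
- by rewrite !subr_eq0 [b' == a']eq_sym ab' orbT.
- by apply: hx => //; rewrite lt_neqAle p0.
Qed.

End Factors.

Section Normalize.
Variable R : realType.

Lemma arg_increment_pos (F G : R -> R[i]) d : arg_increment F d ->
  (forall t, t \in `[0, 1] -> exists2 k, 0 < k & G t = k%:C * F t) ->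
  arg_increment G d.
Proof.
move=> [g [cg Fg gd]] FG; exists g; split => // t t01.
have [k k0 ->] := FG t t01; rewrite -[g t]add0r; apply: is_argM; last exact: Fg.
exact: is_arg_pos.
Qed.

Definition normalize (z : R[i]) := z * (modulus z)^-1%:C.

Lemma modulus_gt0 (z : R[i]) : z != 0 -> 0 < modulus z.
Proof.
move=> z0; rewrite lt_def modulus_ge0 andbT; apply/eqP => c0.
have := modulus_sqr z; rewrite c0 expr0n /=; move: z0; case: z {c0} => a b /=.
move=> /eqP nz e; apply: nz; have a2 := sqr_ge0 a; have b2 := sqr_ge0 b.
have /eqP : a ^+ 2 = 0 by lra.
have /eqP : b ^+ 2 = 0 by lra.
by rewrite !sqrf_eq0 => /eqP -> /eqP ->.
Qed.

Lemma normalize_unimodular (z : R[i]) : z != 0 -> unimodular (normalize z).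
Proof.
move=> /modulus_gt0 c0; have := modulus_sqr z; rewrite /unimodular /normalize.
move: (modulus z) c0; case: z => a b /= c c0 e.
transitivity ((a ^+ 2 + b ^+ 2) * c^-1 ^+ 2); first by ring.
by rewrite -e -exprMn divff ?expr1n// lt0r_neq0.
Qed.

Lemma normalizeE (z : R[i]) : z != 0 -> z = (modulus z)%:C * normalize z.
Proof.
move=> /modulus_gt0 c0; rewrite /normalize mulrCA -rmorphM divff ?lt0r_neq0//.
by rewrite rmorph1 mulr1.
Qed.

Lemma normalize_continuous (T : topologicalType) (f : T -> R[i]) p :
  ccontinuous_at f p -> f p != 0 -> ccontinuous_at (fun q => normalize (f q)) p.
Proof.
move=> cf f0; apply: ccontinuousM => //; split => /=; last exact: cst_continuous.
apply: continuousV; first exact/lt0r_neq0/modulus_gt0.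
case: cf => c1 c2.
apply: (@continuous_comp _ _ _
  (fun y => complex.Re (f y) ^+ 2 + complex.Im (f y) ^+ 2) Num.sqrt).
  by apply: continuous_add; exact: continuousM.
exact: sqrt_continuous.
Qed.

End Normalize.

Section Strands.
Variables (R : realType) (n : nat) (pi : 'S_n).
Implicit Types (i j : 'I_n).
Local Notation c := (@Defs.coord R n).

Definition vertical_path i (t : R) :=
  pt3 (c i) (line_path (c i) (c (pi i)) t) (t * (1 - t)).

Definition horizontal_path i (t : R) :=
  pt3 (line_path (c i) (c (pi i)) t) (c (pi i)) 0.

Lemma line_path_continuous (a b : R) : continuous (line_path a b).
Proof.
move=> t; have ct : {for t, continuous (fun t : R => t)} by exact: cvg_id.
apply: continuous_add.
  by apply: continuousM; [apply: continuous_sub => //|]; exact: cst_continuous.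
by apply: continuousM => //; exact: cst_continuous.
Qed.

Lemma vertical_path_continuous i : continuous (vertical_path i).
Proof.
move=> t; have ct : {for t, continuous (fun t : R => t)} by exact: cvg_id.
apply: (@pt3_continuous _ _ (cst (c i)) (line_path (c i) (c (pi i)))
  (fun t : R => t * (1 - t))); [exact: cst_continuous|exact: line_path_continuous|].
by apply: continuousM => //; apply: continuous_sub => //; exact: cst_continuous.
Qed.

Lemma horizontal_path_continuous i : continuous (horizontal_path i).
Proof.
by move=> t; apply: (@pt3_continuous _ _ (line_path (c i) (c (pi i)))
  (cst (c (pi i))) (cst 0)); [exact: line_path_continuous| |]; exact: cst_continuous.
Qed.

Lemma vertical_path0 i : vertical_path i 0 = pt3 (c i) (c i) 0.
Proof. by rewrite /vertical_path line_path0 mul0r. Qed.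

Lemma vertical_path1 i : vertical_path i 1 = pt3 (c i) (c (pi i)) 0.
Proof. by rewrite /vertical_path line_path1 subrr mulr0. Qed.

Lemma horizontal_path0 i : horizontal_path i 0 = pt3 (c i) (c (pi i)) 0.
Proof. by rewrite /horizontal_path line_path0. Qed.

Lemma horizontal_path1 i : horizontal_path i 1 = pt3 (c (pi i)) (c (pi i)) 0.
Proof. by rewrite /horizontal_path line_path1. Qed.

Lemma pt3_norm (r x y z : R) : `|x| <= r -> `|y| <= r -> `|z| <= r -> `|pt3 x y z| <= r.
Proof.
move=> xr yr zr; rewrite [leLHS]/Num.norm /= mx_normrE.
apply/bigmax_leP; split=> [|[k k'] _ /=]; first exact: le_trans xr.
by rewrite mxE; case: k' => -[|[|[|//]]].
Qed.

Lemma coord_bound i : 0 < c i <= n%:R.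
Proof. by rewrite /Defs.coord ltr0n ler_nat /=. Qed.

Lemma line_path_bound (a b r t : R) : 0 < a <= r -> 0 < b <= r -> 0 <= t <= 1 ->
  `|line_path a b t| <= r.
Proof.
by move=> ? ? ?; rewrite ler_norml /line_path; apply/andP; split; nra.
Qed.

Lemma strand_norm i t : 0 <= t <= 1 ->
  `|vertical_path i t| <= n%:R /\ `|horizontal_path i t| <= n%:R.
Proof.
move=> t01; have ci := coord_bound i; have cpi := coord_bound (pi i).
have n1 : 1 <= n%:R :> R by rewrite ler1n; case: (i) => m; case: (n).
have ab (x : R) : 0 < x <= n%:R -> `|x| <= n%:R.
  by move=> /andP[x0 xn]; rewrite gtr0_norm.
split; apply: pt3_norm;
  [exact: ab|exact: line_path_bound| |exact: line_path_bound|exact: ab|].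
  by rewrite ler_norml; apply/andP; split; nra.
by rewrite normr0.
Qed.

End Strands.

Section FactorCont.
Variables (R : realType) (n : nat) (w : 'S_n).
Local Notation c := (@Defs.coord R n).

Lemma up_pairing_continuous (T : topologicalType) (f g h f' g' h' : T -> R) q :
  {for q, continuous f} -> {for q, continuous g} -> {for q, continuous h} ->
  {for q, continuous f'} -> {for q, continuous g'} -> {for q, continuous h'} ->
  ccontinuous_at (fun t => up_pairing (f t) (g t) (h t) (f' t) (g' t) (h' t)) q.
Proof.
move=> cf cg ch cf' cg' ch'.
have [cu _] := pauli_entry_continuous false false cf cg ch.
have [cu' _] := pauli_entry_continuous false false cf' cg' ch'.
apply: ccontinuousD; first by split => /=; [exact: continuousM|exact: cst_continuous].
by apply: ccontinuousM; split => //=; exact: (@continuousN _ R^o).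
Qed.

Lemma factor_continuous j p :
  ccontinuous_at (@vertical_factor R n w j) p /\
  ccontinuous_at (@horizontal_factor R n w j) p.
Proof.
have cX (k : R) : {for p, continuous (fun p => k - cx p)}.
  by apply: continuous_sub; [exact: cst_continuous|exact: cx_continuous].
have cY (k : R) : {for p, continuous (fun p => k - cy p)}.
  by apply: continuous_sub; [exact: cst_continuous|exact: cy_continuous].
have cZ : {for p, continuous (fun p : 'rV[R]_3 => - cz p)}.
  by apply: (@continuousN _ R^o); exact: cz_continuous.
have cL : {for p, continuous (fun p => lift_height w j p - cz p)}.
  by apply: continuous_sub; [exact: lift_height_continuous|exact: cz_continuous].
by split; apply: up_pairing_continuous.
Qed.

End FactorCont.

Section NoCrossing.
Variables (R : realType) (n : nat) (w : 'S_n) (A B : {set 'I_n}).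
Hypothesis der : derangement w.
Hypothesis wA : forall i, (w i \in A) = (i \in A).
Hypothesis wB : forall i, (w i \in B) = (i \in B).
Hypothesis AB : forall i, i \in A -> i \notin B.
Local Notation c := (@Defs.coord R n).

Lemma coord_eq i j : (c i == c j) = (i == j).
Proof. by apply/eqP/eqP => [/Defs.coord_inj|->]. Qed.

Lemma coord_lt i j : (c i < c j) = (i < j)%N.
Proof. by rewrite /Defs.coord ltr_nat ltnS. Qed.

Section pair.
Variables i j : 'I_n.
Hypotheses (iA : i \in A) (jB : j \in B).

Lemma ends_neq : [/\ c i != c j, c i != c (w j), c (w i) != c j & c (w i) != c (w j)].
Proof.
by split; rewrite coord_eq; apply: contraTneq jB;
  [move=> <-|rewrite -wB => <-|move=> <-|rewrite -wB => <-]; apply: AB; rewrite ?wA.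
Qed.

Lemma coord_w k : c k != c (w k).
Proof. by have := coord_neq R der k; rewrite subr_eq0 eq_sym. Qed.

Lemma vertical_path_vertical_slit (t : R) :
  slit_plane (vertical_factor w j (vertical_path w i t)).
Proof.
have [n1 n2 n3 n4] := ends_neq; have nj := coord_w j.
rewrite /vertical_factor cx_pt3 cy_pt3; apply: slit_up_pairing_Im.
set y := line_path _ _ _.
rewrite (_ : _ - _ = (c j - c i) * (c (w j) - c j)); last by ring.
by rewrite mulf_neq0// subr_eq0 eq_sym.
Qed.

Lemma horizontal_path_horizontal_slit (t : R) :
  slit_plane (horizontal_factor w j (horizontal_path w i t)).
Proof.
have [n1 n2 n3 n4] := ends_neq; have nj := coord_w j.
rewrite /horizontal_factor cx_pt3 cy_pt3; apply: slit_up_pairing_Im.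
set x := line_path _ _ _.
rewrite (_ : _ - _ = (c (w j) - c (w i)) * (c j - c (w j))); last by ring.
by rewrite mulf_neq0// subr_eq0// eq_sym.
Qed.

Lemma horizontal_path_vertical_slit (t : R) :
  slit_plane (vertical_factor w j (horizontal_path w i t)).
Proof.
have [n1 n2 n3 n4] := ends_neq; have nj := coord_w j.
rewrite /vertical_factor cx_pt3 cy_pt3 cz_pt3; apply: slit_vertical_side => // _ neg.
rewrite /lift_height cy_pt3.
have d0 : 0 < (c (w j) - c j) ^+ 2 by rewrite exprn_even_gt0//= subr_eq0 eq_sym.
have e : (c (w j) - c (w i)) / (c (w j) - c j) * (c (w j) - c j) ^+ 2 =
  (c (w j) - c (w i)) * (c (w j) - c j).
  by rewrite expr2 mulrA divfK// subr_eq0 eq_sym.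
by rewrite -(pmulr_lgt0 _ d0) e; nra.
Qed.

Lemma line_path_between (a b t y : R) : 0 <= t <= 1 -> line_path a b t = y ->
  a != y -> b != y -> [/\ 0 < t * (1 - t) & (y - a) * (y - b) < 0].
Proof.
move=> /andP[t0 t1]; rewrite /line_path => <- ay byy.
have tn0 : t != 0 by apply: contra_neq ay => ->; ring.
have tn1 : t != 1 by apply: contra_neq byy => ->; ring.
have tp : 0 < t * (1 - t) by rewrite mulr_gt0// ?subr_gt0 lt_neqAle ?t0 ?t1 ?andbT//
  eq_sym.
have ab : a != b by apply: contra_neq ay => ->; ring.
split => //.
have : 0 < (a - b) ^+ 2 by rewrite exprn_even_gt0//= subr_eq0.
rewrite (_ : _ * _ = - (t * (1 - t) * (a - b) ^+ 2)); last by ring.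
by move=> ?; rewrite oppr_lt0 mulr_gt0.
Qed.

Lemma vertical_path_horizontal_slit (t : R) : 0 <= t <= 1 -> ~~ passes_over w i j ->
  slit_plane (horizontal_factor w j (vertical_path w i t)).
Proof.
have [n1 n2 n3 n4] := ends_neq; have nj := coord_w j.
move=> t01 nover.
rewrite /horizontal_factor cx_pt3 cy_pt3; apply: slit_horizontal_side => // ey.
have [_ btw] := line_path_between t01 ey n2 n4.
have p0 : (c j - c i) * (c (w j) - c i) != 0 by rewrite mulf_neq0// subr_eq0 eq_sym.
rewrite ltNge; apply: contra nover => neg; rewrite /passes_over -!coord_lt.
have {}neg : (c j - c i) * (c (w j) - c i) < 0 by rewrite lt_neqAle p0.
have [ij|ij] := ltP (c j) (c i).
  have h1 : c i < c (w j) by nra.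
  have h2 : c (w j) < c (w i) by nra.
  by rewrite h1 h2.
have {}ij : c i < c j by rewrite lt_neqAle n1.
have h1 : c (w j) < c i by nra.
have h2 : c (w i) < c (w j) by nra.
by rewrite h1 h2 ij orbT.
Qed.

(** In both cases of [passes_over] the imaginary part increases from a negative
    to a positive value; this is the equality of the signs of all crossings. *)
Lemma vertical_path_horizontal_cross : passes_over w i j ->
  [/\ forall t : R, 0 <= t <= 1 ->
        slit_plane (- horizontal_factor w j (vertical_path w i t)),
      complex.Im (horizontal_factor w j (vertical_path w i (0 : R))) < 0 &
      0 < complex.Im (horizontal_factor w j (vertical_path w i (1 : R)))].
Proof.
have [n1 n2 n3 n4] := ends_neq; have nj := coord_w j.
rewrite /passes_over -!coord_lt => over.
have e (y x : R) : (c j - x) * (c (w j) - y) - (c (w j) - y) * (c (w j) - x) =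
    (c (w j) - y) * (c j - c (w j)) by ring.
split.
- move=> t t01; rewrite /horizontal_factor cx_pt3 cy_pt3.
  apply: slit_opp_horizontal => // ey.
  have [tp _] := line_path_between t01 ey n2 n4.
  rewrite /lift_height cy_pt3 ey subrr mul0r cz_pt3; split => //.
  by case/orP: over => [/andP[/andP[? ?] ?]|/andP[? /andP[? ?]]]; nra.
- rewrite /horizontal_factor up_pairing_Im cx_pt3 cy_pt3 e line_path0.
  by case/orP: over => [/andP[/andP[? ?] ?]|/andP[? /andP[? ?]]]; nra.
- rewrite /horizontal_factor up_pairing_Im cx_pt3 cy_pt3 e line_path1.
  by case/orP: over => [/andP[/andP[? ?] ?]|/andP[? /andP[? ?]]]; nra.
Qed.

End pair.
End NoCrossing.

Section Separation.
Variables (R : realType) (n : nat) (w : 'S_n) (A B : {set 'I_n}).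
Hypothesis der : derangement w.
Hypothesis wA : forall i, (w i \in A) = (i \in A).
Hypothesis wB : forall i, (w i \in B) = (i \in B).
Hypothesis AB : forall i, i \in A -> i \notin B.
Local Notation c := (@Defs.coord R n).
Local Notation Phi := (@linking_map R n w B).
Local Notation tpi := (trigo.pi : R).

(** Sum of the principal arguments of all factors.  It only depends on the point,
    so its variations cancel along closed curves. *)
Definition total_arg (p : 'rV[R]_3) :=
  \sum_(j in B) (arg (vertical_factor w j p) + arg (horizontal_factor w j p)).

(** Only the factors of the horizontal strands that are passed over meet the cut. *)
Lemma increment_vertical_path i : i \in A ->
  arg_increment (fun t => Phi (vertical_path w i t))
    (total_arg (vertical_path w i 1) - total_arg (vertical_path w i 0)
      - (tpi *+ 2) *+ #|[set j in B | passes_over w i j]|).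
Proof.
move=> iA.
have -> : total_arg (vertical_path w i 1) - total_arg (vertical_path w i 0)
      - (tpi *+ 2) *+ #|[set j in B | passes_over w i j]| =
  \sum_(j in B) (
    (arg (vertical_factor w j (vertical_path w i 1))
     - arg (vertical_factor w j (vertical_path w i 0))) +
    (arg (horizontal_factor w j (vertical_path w i 1))
     - arg (horizontal_factor w j (vertical_path w i 0))
     - (tpi *+ 2) *+ passes_over w i j)).
  have -> : #|[set j in B | passes_over w i j]| = (\sum_(j in B) passes_over w i j)%N.
    rewrite -sum1_card big_mkcond [RHS]big_mkcond /=; apply: eq_bigr => j _.
    by rewrite inE; case: (j \in B); case: passes_over.
  rewrite -sumrMnr -!sumrB; apply: eq_bigr => j _; ring.
pose F (t : R) := \prod_(j in B) (vertical_factor w j (vertical_path w i t) *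
  horizontal_factor w j (vertical_path w i t)).
have cf j (t : R) :
    ccontinuous_at (fun t => vertical_factor w j (vertical_path w i t)) t /\
    ccontinuous_at (fun t => horizontal_factor w j (vertical_path w i t)) t.
  have [c1 c2] := factor_continuous w j (vertical_path w i t).
  have cp := @vertical_path_continuous R n w i t; split.
    exact: (ccontinuous_comp (u := vertical_factor w j) cp c1).
  exact: (ccontinuous_comp (u := horizontal_factor w j) cp c2).
apply: (@arg_increment_pos _ F).
  apply: arg_increment_prod => j jB; apply: arg_incrementM.
    apply: arg_increment_slit => t; first by case: (cf j t).
    by move=> _; exact: (vertical_path_vertical_slit der wA wB AB).
  have [over|nover] := boolP (passes_over w i j).
    have [h1 h2 h3] := vertical_path_horizontal_cross R der wA wB AB iA jB over.
    rewrite mulr1n; apply: arg_increment_cross => // t.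
    by case: (cf j t).
  rewrite mulr0n subr0; apply: arg_increment_slit => t; first by case: (cf j t).
  rewrite in_itv => /= t01.
  exact: (vertical_path_horizontal_slit der wA wB AB iA jB t01 nover).
move=> t _; apply: linking_map_factor => // j jB;
  have [n1 n2 n3 n4] := ends_neq R wA wB AB iA jB.
  by rewrite cx_pt3 subr_eq0 eq_sym n1.
by rewrite cx_pt3 subr_eq0 eq_sym n1.
Qed.

(** A horizontal strand of A passes below the vertical strands of B, so that no
    factor meets the cut. *)
Lemma increment_horizontal_path i : i \in A ->
  arg_increment (fun t => Phi (horizontal_path w i t))
    (total_arg (horizontal_path w i 1) - total_arg (horizontal_path w i 0)).
Proof.
move=> iA.
have -> : total_arg (horizontal_path w i 1) - total_arg (horizontal_path w i 0) =
  \sum_(j in B) (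
    (arg (vertical_factor w j (horizontal_path w i 1))
     - arg (vertical_factor w j (horizontal_path w i 0))) +
    (arg (horizontal_factor w j (horizontal_path w i 1))
     - arg (horizontal_factor w j (horizontal_path w i 0)))).
  by rewrite -!sumrB; apply: eq_bigr => j _; ring.
pose F (t : R) := \prod_(j in B) (vertical_factor w j (horizontal_path w i t) *
  horizontal_factor w j (horizontal_path w i t)).
have cf j (t : R) :
    ccontinuous_at (fun t => vertical_factor w j (horizontal_path w i t)) t /\
    ccontinuous_at (fun t => horizontal_factor w j (horizontal_path w i t)) t.
  have [c1 c2] := factor_continuous w j (horizontal_path w i t).
  have cp := @horizontal_path_continuous R n w i t; split.
    exact: (ccontinuous_comp (u := vertical_factor w j) cp c1).
  exact: (ccontinuous_comp (u := horizontal_factor w j) cp c2).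
apply: (@arg_increment_pos _ F).
  apply: arg_increment_prod => j jB; apply: arg_incrementM.
    apply: arg_increment_slit => t; first by case: (cf j t).
    by move=> _; exact: (horizontal_path_vertical_slit der wA wB AB iA jB).
  apply: arg_increment_slit => t; first by case: (cf j t).
  by move=> _; exact: (horizontal_path_horizontal_slit der wA wB AB).
move=> t _; apply: linking_map_factor => // j jB;
  have [n1 n2 n3 n4] := ends_neq R wA wB AB iA jB.
  by rewrite cy_pt3 !subr_eq0 [c j == c (w i)]eq_sym n3 orbT.
by rewrite cy_pt3 !subr_eq0 [c (w j) == c (w i)]eq_sym n4 orbT.
Qed.

(** Add up the variations of a continuous argument of [linking_map] along all
    strands of A.  As w permutes A, the terms that depend only on the ends cancel
    in pairs.  What is left is - 2 pi times the number of passages of A over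
    B. *)
Theorem separated_not_over (S P Q : set 'rV[R]_3) i j :
  homeomorphic (@sphere2 R) S -> open P -> open Q -> P `&` Q = set0 -> P `|` Q = ~` S ->
  (forall i, i \in A -> vertical_strand w i `|` horizontal_strand w i `<=` P) ->
  (forall i, i \in B -> vertical_strand w i `|` horizontal_strand w i `<=` Q) ->
  i \in A -> j \in B -> ~~ passes_over w i j.
Proof.
move=> hS oP oQ PQ0 PQS AP BQ.
have PQ p : P p -> ~ Q p by move=> Pp Qp; have : (P `&` Q) p by []; rewrite PQ0.
have Phi0 p : ~ Q p -> Phi p != 0.
  move=> nQ; apply: linking_map_neq0 => // k kB.
  by split=> sp; apply: nQ; apply: (BQ k kB); [left|right].
have [g gP] := @log_separated R S P Q (fun p => normalize (Phi p)) n%:R hS oP oQ PQ0 PQS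
  (fun p nQ => normalize_continuous (linking_map_continuous _ _ p) (Phi0 p nQ))
  (fun p nQ => normalize_unimodular (Phi0 p nQ)).
have inc (gam : R -> 'rV[R]_3) : continuous gam ->
    (forall t, 0 <= t <= 1 -> P (gam t) /\ `|gam t| <= n%:R) ->
    arg_increment (fun t => Phi (gam t)) (g (gam 1) - g (gam 0)).
  move=> cgam gamP; exists (g \o gam); split => //.
    apply: continuous_in_subspaceT => t /set_mem; rewrite /= in_itv => /gamP[Pt nt].
    by apply: continuous_comp; [exact: cgam|case: (gP _ Pt nt)].
  move=> t; rewrite in_itv => /gamP[Pt nt]; have [_ e] := gP _ Pt nt.
  have P0 := Phi0 _ (PQ _ Pt).
  by exists (modulus (Phi (gam t))); [exact: modulus_gt0|rewrite -e -normalizeE].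
have vP k t : k \in A -> 0 <= t <= 1 ->
    P (vertical_path w k t) /\ `|vertical_path w k t : 'rV[R]_3| <= n%:R.
  move=> kA t01; split; last by case: (strand_norm w k t01).
  by apply: (AP k kA); left; exists t => //=; rewrite in_itv.
have hP k t : k \in A -> 0 <= t <= 1 ->
    P (horizontal_path w k t) /\ `|horizontal_path w k t : 'rV[R]_3| <= n%:R.
  move=> kA t01; split; last by case: (strand_norm w k t01).
  by apply: (AP k kA); right; exists t => //=; rewrite in_itv.
pose al k : 'rV[R]_3 := pt3 (c k) (c k) 0.
(* along the strands of A, this difference varies only at passages over B *)
pose h p := g p - total_arg p.
have step k : k \in A -> h (al (w k)) - h (al k) =
    - ((tpi *+ 2) *+ #|[set j in B | passes_over w k j]|).
  move=> kA.
  have e1 := arg_increment_uniq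
    (inc _ (@vertical_path_continuous R n w k) (fun t => vP k t kA))
    (increment_vertical_path kA).
  have e2 := arg_increment_uniq
    (inc _ (@horizontal_path_continuous R n w k) (fun t => hP k t kA))
    (increment_horizontal_path kA).
  move: e1 e2; rewrite vertical_path0 vertical_path1 horizontal_path0 horizontal_path1
    -/(al k) -/(al (w k)) /h; lra.
have tot : \sum_(k in A) (h (al (w k)) - h (al k)) = 0.
  rewrite sumrB; apply/eqP; rewrite subr_eq0; apply/eqP.
  rewrite [RHS](reindex_inj (@perm_inj _ w)) /=; apply: eq_bigl => k.
  by rewrite wA.
move=> iA jB; apply/negP => over.
have : \sum_(k in A) (h (al (w k)) - h (al k)) < 0.
  rewrite (bigD1 i) //= step// ltr_wnDr//.
    apply: sumr_le0 => k /andP[kA _]; rewrite step// oppr_le0 mulrn_wge0// mulrn_wge0//.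
    exact: pi_ge0.
  have k0 : (0 < #|[set j in B | passes_over w i j]|)%N.
    by apply/card_gt0P; exists j; rewrite inE jB over.
  by rewrite oppr_lt0 pmulrn_lgt0// pmulrn_lgt0// pi_gt0.
by rewrite tot ltxx.
Qed.

End Separation.

(** * From split links to non-crossing invariant sets *)

Section Split.
Variable R : realType.
Implicit Types (S : set 'rV[R]_3) (p q : 'rV[R]_3).

(** Balls are connected, so components of the open complement are open. *)
Lemma open_component_near S p : closed S -> ~ S p ->
  \forall q \near p, connected_component (~` S) q = connected_component (~` S) p.
Proof.
move=> cS nSp; have /nbhs_ballP[e /= e0 eS] : nbhs p (~` S).
  by apply: open_nbhs_nbhs; split => //; exact: closed_openC.
apply/nbhs_ballP; exists e => // q pq; apply: same_connected_component.
pose f (t : R) := p + t *: (q - p).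
have cf : continuous f.
  by move=> t; apply: cvgD; [exact: cvg_cst|exact: scalel_continuous].
have cI : connected (f @` `[0, 1]%classic).
  apply: connected_continuous_connected; first exact: segment_connected.
  exact: continuous_subspaceT.
apply: (connected_component_max _ _ cI).
- by exists 1; rewrite /= ?in_itv/= ?ler01 ?lexx// /f scale1r addrC subrK.
- move=> _ [t + <-]; rewrite /= in_itv /= => /andP[t0 t1]; apply: eS.
  move: pq; rewrite -ball_normE /= /f opprD addNKr normrN normrZ ger0_norm// distrC.
  by apply: le_lt_trans; rewrite ler_piMl.
- by exists 0; rewrite /= ?in_itv/= ?ler01 ?lexx// /f scale0r addr0.
Qed.

Lemma sphere_sides S : closed S ->
  [/\ open (sphere_interior S), open (sphere_exterior S),
      sphere_interior S `&` sphere_exterior S = set0 &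
      sphere_interior S `|` sphere_exterior S = ~` S].
Proof.
move=> cS; split.
- rewrite openE => p [nSp bp]; have near_p := open_component_near cS nSp.
  have nS : \forall q \near p, ~ S q by apply: open_nbhs_nbhs; split => //;
    exact: closed_openC.
  by rewrite /interior; near=> q; split; [near: q|rewrite (near near_p q)].
- rewrite openE => p [nSp bp]; have near_p := open_component_near cS nSp.
  have nS : \forall q \near p, ~ S q by apply: open_nbhs_nbhs; split => //;
    exact: closed_openC.
  by rewrite /interior; near=> q; split; [near: q|rewrite (near near_p q)].
- by apply/seteqP; split => // p [[_ ?] []].
- apply/seteqP; split => [p [[]|[]]//|p nSp].
  by have [b|b] := pselect (bounded_set (connected_component (~` S) p)); [left|right].
Unshelve. all: by end_near. Qed.

Lemma connected_one_side S (C : set 'rV[R]_3) p : connected C -> C `<=` ~` S -> C p ->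
  C `<=` sphere_interior S \/ C `<=` sphere_exterior S.
Proof.
move=> cC CS Cp.
have e q : C q -> connected_component (~` S) q = connected_component (~` S) p.
  by move=> Cq; apply: same_connected_component; exact: connected_component_max cC p Cp.
have [b|b] := pselect (bounded_set (connected_component (~` S) p)); [left|right] => q Cq.
  by split; [exact: CS|rewrite e].
by split; [exact: CS|rewrite e].
Qed.

Variables (n : nat) (w : 'S_n).
Hypothesis der : derangement w.
Local Notation c := (@Defs.coord R n).

Definition strand i := vertical_strand w i `|` horizontal_strand w i : set 'rV[R]_3.
Definition corner i : 'rV[R]_3 := pt3 (c i) (c i) 0.

Lemma strand_corner i : strand i (corner i).
Proof. by left; exists 0; rewrite /= ?in_itv/= ?lexx ?ler01// line_path0 mul0r. Qed.

Lemma strand_next_corner i : strand i (corner (w i)).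
Proof. by right; exists 1; rewrite /= ?in_itv/= ?lexx ?ler01// line_path1. Qed.

Lemma strand_connected i : connected (strand i).
Proof.
apply: connectedU.
- exists (pt3 (c i) (c (w i)) 0); split.
    by exists 1; rewrite /= ?in_itv/= ?lexx ?ler01// line_path1 subrr mulr0.
  by exists 0; rewrite /= ?in_itv/= ?lexx ?ler01// line_path0.
- apply: connected_continuous_connected; first exact: segment_connected.
  exact/continuous_subspaceT/vertical_path_continuous.
- apply: connected_continuous_connected; first exact: segment_connected.
  exact/continuous_subspaceT/horizontal_path_continuous.
Qed.

(** The set A consists of the indices of the strands inside the sphere.  The two
    ways in which strands inside and outside may pass over each other are
    excluded by [separated_not_over], applied once with the interior as the side
    of the upper strands and once with the exterior. *)
Lemma split_link_partition : split_link (@link R n w) -> exists A : {set 'I_n},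
  [/\ A != finset.set0, A != [set: 'I_n]%SET, forall i, (w i \in A) = (i \in A) &
      forall i j, (i \in A) != (j \in A) -> ~~ passes_over w i j].
Proof.
move=> [S [hS SL [K1 [p1 Lp1 ->] K1i] [K2 [p2 Lp2 ->] K2e]]].
have cS := embedded_sphere_closed hS.
have [oI oE IE0 IES] := sphere_sides cS.
have IE p : sphere_interior S p -> sphere_exterior S p -> False.
  by move=> Ip Ep; have : (sphere_interior S `&` sphere_exterior S) p by []; rewrite IE0.
have strandS i : strand i `<=` ~` S.
  move=> p sp Sp; have : (S `&` link w) p by split => //; exists i.
  by rewrite SL.
have side i := connected_one_side (@strand_connected i) (@strandS i) (@strand_corner i).
pose A := [set i | `[< strand i `<=` sphere_interior S >]]%SET.
have AI i : i \in A -> strand i `<=` sphere_interior S by rewrite inE => /asboolP.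
have AE i : i \notin A -> strand i `<=` sphere_exterior S.
  by rewrite inE => /asboolP nI; case: (side i).
clearbody A; have wA i : (w i \in A) = (i \in A).
  apply/idP/idP => iA; apply: contraT => nA.
    by case: (IE _ (AI _ iA _ (@strand_corner (w i))) (AE _ nA _ (@strand_next_corner
      i))).
  by case: (IE _ (AI _ iA _ (@strand_next_corner i)) (AE _ nA _ (@strand_corner (w i)))).
have wA' i : (w i \in ~: A) = (i \in ~: A) by rewrite !inE wA.
exists A; split => //.
- have [i _ si] := Lp1; apply/set0Pn; exists i; apply: contraT => /AE/(_ _ si) ext.
  by case: (IE p1) => //; apply: K1i; exact: connected_component_refl.
- have [i _ si] := Lp2; apply/eqP => AT.
  have /AI/(_ _ si) int : i \in A by rewrite AT inE.
  by case: (IE p2) => //; apply: K2e; exact: connected_component_refl.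
- move=> i j; case iA: (i \in A); case jA: (j \in A) => // _.
    apply: (@separated_not_over R n w A (~: A) der wA wA' _ S _ _ i j hS oI oE IE0 IES)
      => //.
    + by move=> k kA; rewrite inE kA.
    + by move=> k; rewrite inE => /AE.
    + by rewrite inE jA.
  have IE0' : sphere_exterior S `&` sphere_interior S = set0 by rewrite setIC.
  have IES' : sphere_exterior S `|` sphere_interior S = ~` S by rewrite setUC.
  apply: (@separated_not_over R n w (~: A) A der wA' wA _ S _ _ i j hS oE oI IE0' IES')
    => //.
  + by move=> k; rewrite inE.
  + by move=> k; rewrite inE => /AE.
  + by rewrite inE iA.
Qed.

End Split.

(** * The probability *)

Section Probability.
Variable R : realType.

Lemma split_link_stable_interval n (w : 'S_n) :
  derangement w -> split_link (@link R n w) -> stable_interval w.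
Proof.
move=> der /(split_link_partition der)[A [A0 AT wA nover]].
have [a [b [a0 ab bn st]]] := noncrossing_interval A0 AT wA nover.
apply/existsP; exists (Ordinal (leq_ltn_trans ab bn)); apply/existsP; exists (Ordinal bn).
by rewrite /= a0 ab st.
Qed.

(** The constant 39 is 3 times 13: the factor 3 compares n! with the number of
    derangements, and 13 comes from [card_stable_interval]. *)
Lemma prob_nonsplit_bounds n : (5 < n)%N ->
  1 - 39 / n.-1%:R <= prob_nonsplit R n <= 1.
Proof.
move=> n5; rewrite /prob_nonsplit.
set N := #|[pred w : 'S_n | derangement w && _]|.
set D := #|[pred w : 'S_n | derangement w]|.
have D3 : (n`! <= 3 * D)%N by apply: card_derangement_ge; lia.
have bad := card_stable_interval n5.
set M := #|_| in bad.
have DNM : (D <= N + M)%N.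
  rewrite -[D](cardID [pred w | `[< ~ split_link (@link R n w) >]]).
  apply: leq_add.
    by apply: subset_leq_card; apply/fintype.subsetP => w; rewrite !inE andbC.
  apply: subset_leq_card; apply/fintype.subsetP => w; rewrite !inE => /andP[ns der].
  by rewrite der split_link_stable_interval//; move/asboolPn : ns; exact: contrapT.
have ND : (N <= D)%N.
  by apply: subset_leq_card; apply/fintype.subsetP => w; rewrite !inE => /andP[].
have D0 : (0 < D)%N by have := fact_gt0 n; lia.
have D0R : 0 < D%:R :> R by rewrite ltr0n.
have n0R : 0 < n.-1%:R :> R by rewrite ltr0n; lia.
apply/andP; split; last by rewrite ler_pdivrMr// mul1r ler_nat.
have key : (n.-1 * D <= n.-1 * N + 39 * D)%N.
  have : (n.-1 * M <= 39 * D)%N by lia.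
  by have : (n.-1 * D <= n.-1 * (N + M))%N; [rewrite leq_mul2l DNM orbT|rewrite mulnDr;
    lia].
rewrite ler_pdivlMr// mulrBl mul1r lerBlDr.
rewrite -(ler_pM2l n0R) mulrDr.
rewrite (_ : n.-1%:R * (39 / n.-1%:R * D%:R) = 39 * D%:R); last first.
  by field; rewrite lt0r_neq0.
by rewrite -!natrM -natrD ler_nat.
Qed.

End Probability.

Theorem corollary1p5 (R : realType) :
  (fun n : nat => prob_nonsplit R n) @ \oo --> (1 : R).
Proof.
apply/cvgrPdist_le => e e0; near=> n.
have n5 : (5 < n)%N by near: n; exact: nbhs_infty_gt.
have /andP[lo hi] := prob_nonsplit_bounds R n5.
have n0R : 0 < n.-1%:R :> R by rewrite ltr0n; lia.
have ne : 39 / e <= n.-1%:R.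
  have : (Num.truncn (39 / e) < n.-1)%N.
    suff : (Num.truncn (39 / e) + 1 < n)%N by lia.
    by near: n; exact: nbhs_infty_gt.
  rewrite -(ler_nat R) => h; apply: le_trans h; exact/ltW/truncnS_gt.
rewrite ger0_norm ?subr_ge0//.
have : 39 / n.-1%:R <= e.
  by rewrite ler_pdivrMr// mulrC -ler_pdivrMr.
lra.
Unshelve. all: by end_near. Qed.
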